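(* Let $A,B$ be two positive operators on a Hilbert space and let $m,m',M,M'$ be positive real numbers satisfying one of the following conditions: (i) $0<m'I\leq A\leq mI<MI\leq B\leq M'I$; (ii) $0<m'I\leq B\leq mI<MI\leq A\leq M'I$. Put $h=\frac{M}{m}$ and $h'=\frac{M'}{m'}$. Then for every $\nu\in[0,1]$, with $r=\min\{\nu,1-\nu\}$, \begin{align*} (1-\nu)A+\nu B &\geq S(h^{r})\,A\sharp_{\nu}B\\ &\geq A\sharp_{\nu}B\\ &\geq S(h^{r})\left\{(1-\nu)A^{-1}+\nu B^{-1}\right\}^{-1}\\ &\geq \left\{(1-\nu)A^{-1}+\nu B^{-1}\right\}^{-1}, \end{align*} where $S(\cdot)$ is Specht's ratio and $A\sharp_{\nu}B$ is the $\nu$-power mean of $A$ and $B$.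
   Context: Operators are bounded linear operators on a Hilbert space, $I$ is the identity operator, and $\leq$ between self-adjoint operators is the usual (Loewner) order: $X\leq Y$ means $Y-X$ is positive semidefinite. The condition $mI<MI$ means $m<M$. Under (i) or (ii), $A$ and $B$ are invertible. The $\nu$-power mean (weighted geometric mean) is $$A\sharp_{\nu}B=A^{1/2}\left(A^{-1/2}BA^{-1/2}\right)^{\nu}A^{1/2},\qquad \nu\in[0,1],$$ with powers taken in the continuous functional calculus. Specht's ratio is the function $S:(0,\infty)\to\mathbb{R}$ defined by $$S(h)=\frac{h^{\frac{1}{h-1}}}{e\,\log\left(h^{\frac{1}{h-1}}\right)}\quad (h>0,\ h\neq 1),\qquad S(1)=1,$$ where $\log$ is the natural logarithm and $e$ is its base. *)

(* Defs.v *)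
From HB Require Import structures.
From mathcomp Require Export all_boot all_order all_algebra.
From mathcomp Require Export sesquilinear complex.
From mathcomp Require Export all_classical all_reals all_analysis.
Export numFieldNormedType.Exports.
Export Order.TTheory GRing.Theory Num.Theory.

Set Implicit Arguments.
Unset Strict Implicit.
Unset Printing Implicit Defensive.

Local Open Scope classical_set_scope.
Local Open Scope ring_scope.
Local Open Scope complex_scope.

(* A complex Hilbert space is a complete normed space [H] over [R[i]] together
   with an inner product [ip] (linear in its first argument) inducing the norm:
   [ip_norm ip].  Operators are plain functions [H -> H], so that sums and
   scalings are pointwise and the product of operators is [\o]. *)

Definition ip_norm (R : realType) (H : completeNormedModType R[i])
    (ip : {dot H for @Num.conj R[i]}) : Prop :=
  forall x : H, `|x| ^+ 2 = ip x x.

Section Operators.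
Variables (R : realType) (H : completeNormedModType R[i]).
Implicit Types (T X Y : H -> H) (f : R -> R) (p : {poly R}).

Definition bounded_op T : Prop := linear T /\ continuous T.

Definition scalar_op (a : R) : H -> H := a%:C *: (id : H -> H).

Definition is_inverse T Y : Prop :=
  [/\ bounded_op Y, T \o Y = id & Y \o T = id].

(* the zero operator when [T] is not invertible *)
Definition op_inv T : H -> H := xget (0 : H -> H) [set Y | is_inverse T Y].

Definition spectrum T : set R[i] :=
  [set z | ~ exists Y, is_inverse (T - z *: (id : H -> H)) Y].

Definition op_horner p T : H -> H :=
  \sum_(i < size p) (p`_i)%:C *: (iter i T : H -> H).

(* convergence in operator norm *)
Definition op_cvg (P : nat -> H -> H) X : Prop :=
  forall e : R, 0 < e ->
    \forall n \near \oo, forall x : H, `|P n x - X x| <= e%:C * `|x|.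

(* Continuous functional calculus of a self-adjoint [T] (whose spectrum is real)
   at a function [f] continuous on the spectrum: [f(T)] is the operator-norm
   limit of [p_n(T)], for real polynomials [p_n] converging to [f] uniformly on
   the spectrum of [T].  This limit exists and does not depend on the [p_n]. *)
Definition is_cfc f T X : Prop :=
  exists p : nat -> {poly R},
    {uniform [set t : R | spectrum T t%:C],
       (fun n (t : R) => (p n).[t]) @ \oo --> f} /\
    op_cvg (fun n => op_horner (p n) T) X.

Definition cfc f T : H -> H := xget (0 : H -> H) [set X | is_cfc f T X].

Definition op_pow T (a : R) : H -> H := cfc (fun t : R => t `^ a) T.

Definition power_mean (nu : R) (A B : H -> H) : H -> H :=
  op_pow A 2^-1 \o
  op_pow (op_pow A (- 2^-1) \o B \o op_pow A (- 2^-1)) nu \o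
  op_pow A 2^-1.

End Operators.

Section Loewner.
Variables (R : realType) (H : completeNormedModType R[i]).
Variable ip : {dot H for @Num.conj R[i]}.

(* In the order of [R[i]], [0 <= z] says that [z] is real and nonnegative; as
   [H] is complex, a positive operator is therefore self-adjoint. *)
Definition positive_op (T : H -> H) : Prop := forall x : H, 0 <= ip (T x) x.

Definition loewner_le (X Y : H -> H) : Prop := positive_op (Y - X).

End Loewner.

Definition specht (R : realType) (h : R) : R :=
  if h == 1 then 1
  else h `^ (h - 1)^-1 / (expR 1 * ln (h `^ (h - 1)^-1)).

(* Main.v *)
From HB Require Import structures.
Require Import Defs.
From mathcomp Require Import ring lra.

(* For scalars, Specht's ratio is [S(y) = ag_ratio t y], the quotient of the
   weighted arithmetic and geometric means of 1 and [y], at the weight [t] where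
   that quotient is largest; expanding it and using the weighted AM-GM inequality
   twice gives [S(h^r) x^nu <= (1 - nu) + nu x] whenever [x >= h] or [x <= 1/h].
   With [X = A^(-1/2) B A^(-1/2)], the arithmetic, geometric and harmonic means
   of [A] and [B] are all of the form [A^(1/2) f(X) A^(1/2)], and the spectrum of
   [X] lies in [[h, h']] or in [[1/h', 1/h]], so each inequality is a scalar one.

   The functional calculus rests on the fact that [p(T) >= 0] when the
   polynomial [p] is nonnegative on the spectrum of a self-adjoint [T]: the
   largest [l] with [p(T) >= l] makes [p(T) - l] noninvertible, hence, factoring
   [p - l] over the complex numbers, [l = p(t)] for some [t] in the spectrum. *)

Set Implicit Arguments.
Unset Strict Implicit.
Unset Printing Implicit Defensive.

Local Open Scope classical_set_scope.
Local Open Scope ring_scope.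
Local Open Scope complex_scope.

(** * Specht's ratio *)

Section Specht.
Variable R : realType.
Implicit Types (t x y z a h nu r : R).

(** Use [1 + u <= expR u] at [u = - a ln x] with weight [1 - a] and at [u = (1 - a) ln x] with
    weight [a]: the linear terms cancel. Then multiply by [x^a]. *)
Lemma weighted_young a x : 0 <= a <= 1 -> 0 < x -> x `^ a <= 1 - a + a * x.
Proof.
move=> /andP[a0 a1] x0.
have p0 : 0 < x `^ a by rewrite powR_gt0.
have E1 : expR (- (a * ln x)) = (x `^ a)^-1 by rewrite expRN /powR gt_eqF.
have E2 : expR ((1 - a) * ln x) = x / x `^ a.
  by rewrite mulrBl mul1r expRB lnK ?posrE// /powR gt_eqF.
have : 1 <= (1 - a) * (x `^ a)^-1 + a * (x / x `^ a).
  rewrite -E2 -E1.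
  have h1 := expR_ge1Dx (- (a * ln x)); have h2 := expR_ge1Dx ((1 - a) * ln x).
  apply: le_trans (lerD (ler_wpM2l _ h1) (ler_wpM2l a0 h2)); last lra.
  by rewrite le_eqVlt; apply/orP; left; apply/eqP; ring.
rewrite mulrA -mulrDl ler_pdivlMr// mul1r; exact.
Qed.

Lemma powRVl x a : 0 <= x -> x^-1 `^ a = (x `^ a)^-1.
Proof. by move=> x0; rewrite -!powR_inv1 ?powR_ge0// powRAC. Qed.

Definition ag_ratio t z : R := (1 - t + t * z) / z `^ t.

Lemma ag_ratio_ge1 t z : 0 <= t <= 1 -> 0 < z -> 1 <= ag_ratio t z.
Proof.
by move=> t01 z0; rewrite /ag_ratio ler_pdivlMr ?powR_gt0// mul1r weighted_young.
Qed.

(** Turns an argument below [1/h] into one above [h], at the cost of exchanging the weights. *)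
Lemma ag_ratioV t z : 0 < z -> ag_ratio t z^-1 = ag_ratio (1 - t) z.
Proof.
move=> z0; rewrite /ag_ratio powRVl ?ltW// powRB ?(gt_eqF z0) ?implybT// powRr1 ?ltW//.
have p0 : z `^ t != 0 by rewrite gt_eqF// powR_gt0.
field; rewrite p0 gt_eqF//.
Qed.

(** Write [z = q y] with [q >= 1]. Since [q^t <= 1 - t + t q], it suffices that [(1 - t + t y)(1 - t
    + t q) <= 1 - t + t q y], where the difference is [t (1 - t) (y - 1) (q - 1)]. *)
Lemma ag_ratio_le t y z : 0 <= t <= 1 -> 1 <= y -> y <= z ->
  ag_ratio t y <= ag_ratio t z.
Proof.
move=> t01 y1 yz; have y0 : 0 < y by lra.
have z0 : 0 < z by lra.
have q0 : 0 < z / y by rewrite divr_gt0.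
have q1 : 1 <= z / y by rewrite ler_pdivlMr// mul1r.
have := weighted_young t01 q0.
have -> : (z / y) `^ t = z `^ t / y `^ t.
  by rewrite powRM ?invr_ge0 ?ltW// powRVl ?ltW.
move: (z / y) q0 q1 (divfK (lt0r_neq0 y0) z) => q q0 q1 zE Y.
rewrite /ag_ratio ler_pdivrMr ?powR_gt0// mulrAC ler_pdivlMr ?powR_gt0//.
rewrite ler_pdivrMr ?powR_gt0// in Y.
have {}Y : (1 - t + t * y) * z `^ t <= (1 - t + t * y) * ((1 - t + t * q) * y `^ t).
  by rewrite ler_wpM2l//; case/andP: t01 => ? ?; nra.
apply: le_trans Y _; rewrite mulrA ler_wpM2r ?powR_ge0// -zE.
have : 0 <= t * (1 - t) * ((y - 1) * (q - 1)).
  by case/andP: t01 => ? ?; rewrite !mulr_ge0//; lra.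
nra.
Qed.

(* Expanding the product, both exponents [nu (1 - t)] and [nu (2 - t)] lie in
   [0, 1] and their average with weights [1 - t] and [t] is [nu]. *)
Lemma ag_ratio_powR_le t nu x : 0 <= t <= 1 -> 0 <= nu <= 2^-1 -> 0 < x ->
  ag_ratio t (x `^ nu) * x `^ nu <= 1 - nu + nu * x.
Proof.
move=> /andP[t0 t1] /andP[n0 n1] x0; rewrite /ag_ratio.
have x0' : x != 0 by rewrite gt_eqF.
have -> : (1 - t + t * x `^ nu) / (x `^ nu) `^ t * x `^ nu =
    (1 - t) * x `^ (nu * (1 - t)) + t * x `^ (nu * (2 - t)).
  have -> : nu * (1 - t) = nu - nu * t by ring.
  have -> : nu * (2 - t) = nu + (nu - nu * t) by ring.
  rewrite (@powRD _ x nu (nu - nu * t)) ?x0' ?implybT// powRB ?x0' ?implybT// -powRrM.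
  ring.
have Y1 := @weighted_young (nu * (1 - t)) x _ x0.
have Y2 := @weighted_young (nu * (2 - t)) x _ x0.
apply: le_trans (lerD (ler_wpM2l _ (Y1 _)) (ler_wpM2l t0 (Y2 _))) _.
- by lra.
- by apply/andP; split; nra.
- by apply/andP; split; nra.
- by rewrite le_eqVlt; apply/orP; left; apply/eqP; ring.
Qed.

Lemma specht_ag_ratio y : 1 <= y ->
  exists2 t, 0 <= t <= 1 & specht y = ag_ratio t y.
Proof.
move=> y1; rewrite /specht; have [->|yn1] := eqVneq y 1.
  by exists 0; rewrite ?lexx ?ler01// /ag_ratio powR1; field.
have {yn1 y1}y1 : 1 < y by rewrite lt_neqAle eq_sym yn1.
have y0 : 0 < y by lra.
have d0 : 0 < y - 1 by lra.
have l0 : 0 < ln y by rewrite ln_gt0.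
have lle : ln y <= y - 1 by have := @le_ln1Dx _ (y - 1); rewrite (addrC 1) subrK; apply; lra.
have lge : y - 1 <= y * ln y.
  have : ln y^-1 <= y^-1 - 1.
    have := @le_ln1Dx _ (y^-1 - 1); rewrite (addrC 1) subrK; apply.
    by have yV0 : 0 < y^-1; [rewrite invr_gt0 | lra].
  rewrite lnV ?posrE// => h.
  have := ler_wpM2l (ltW y0) h; rewrite mulrBr mulfV ?gt_eqF//; lra.
(* This is the critical point of [ag_ratio t y] in [t], where [1 + t (y - 1) = (y - 1) / ln y]. It
   is nonnegative because [ln y <= y - 1], and at most 1 because [y - 1 <= y ln y]. *)
exists ((ln y)^-1 - (y - 1)^-1).
  apply/andP; split; first by rewrite subr_ge0 lef_pV2 ?posrE.
  have -> : (y - 1)^-1 = (ln y)^-1 * (ln y / (y - 1)) by field; rewrite !gt_eqF.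
  rewrite -[X in X - _]mulr1 -mulrBr mulrC ler_pdivrMr// mul1r.
  have -> : 1 - ln y / (y - 1) = (y - 1 - ln y) / (y - 1) by field; rewrite gt_eqF.
  by rewrite ler_pdivrMr//; nra.
rewrite /ag_ratio.
(* The factor [e] of Specht's ratio arises as [y^(1 / ln y)]. *)
have -> : y `^ ((ln y)^-1 - (y - 1)^-1) = expR 1 / y `^ (y - 1)^-1.
  rewrite powRB ?(gt_eqF y0) ?implybT//; congr (_ / _).
  by rewrite /powR gt_eqF// mulVf// gt_eqF.
rewrite ln_powR.
have e0 : expR (1 : R) != 0 by rewrite gt_eqF ?expR_gt0.
have p0 : y `^ (y - 1)^-1 != 0 by rewrite gt_eqF ?powR_gt0.
by field; rewrite e0 p0 !gt_eqF.
Qed.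

Lemma specht_ge1 y : 1 <= y -> 1 <= specht y.
Proof.
move=> y1; have [t t01 ->] := specht_ag_ratio y1.
by rewrite ag_ratio_ge1//; lra.
Qed.

Lemma specht_young h nu x : 1 <= h -> 0 <= nu <= 1 -> 0 < x ->
  (h <= x) \/ (x <= h^-1) ->
  specht (h `^ Num.min nu (1 - nu)) * x `^ nu <= 1 - nu + nu * x.
Proof.
move=> h1; have h0 : 0 < h by lra.
have small k w : 0 <= k <= 2^-1 -> 0 < w -> (h <= w) \/ (w <= h^-1) ->
    specht (h `^ k) * w `^ k <= 1 - k + k * w.
  move=> k01 w0 hw; have k0 : 0 <= k by case/andP: k01.
  have hk : 1 <= h `^ k.
    by rewrite -[leLHS](powRr0 h) ler_powR.
  have [t t01 ->] := specht_ag_ratio hk.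
  case: hw => hw.
    apply: le_trans (ag_ratio_powR_le t01 k01 w0).
    rewrite ler_wpM2r ?powR_ge0// ag_ratio_le// ge0_ler_powR// ?nnegrE; lra.
  (* Here [w^k] is below 1, so the expansion is used at the weight [1 - t], and [ag_ratioV] brings
     the comparison back to [t] and [(w^-1)^k >= h^k]. *)
  have t01' : 0 <= 1 - t <= 1 by case/andP: t01 => ? ?; apply/andP; split; lra.
  apply: le_trans (ag_ratio_powR_le t01' k01 w0).
  rewrite ler_wpM2r ?powR_ge0//.
  rewrite -ag_ratioV ?powR_gt0//.
  have -> : (w `^ k)^-1 = (w^-1) `^ k.
    by rewrite powRVl ?ltW.
  have hw' : h <= w^-1 by rewrite -[h]invrK lef_pV2// posrE invr_gt0.
  rewrite ag_ratio_le// ge0_ler_powR// ?nnegrE; lra.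
move=> /andP[n0 n1] x0 hx.
have [nle|nge] := leP nu (1 - nu); first by apply: small => //; lra.
(* For [nu > 1/2], apply the first case to [x^-1] with weight [1 - nu] and multiply by [x]. *)
have k01 : 0 <= 1 - nu <= 2^-1 by lra.
have w0 : 0 < x^-1 by rewrite invr_gt0.
have hw : h <= x^-1 \/ x^-1 <= h^-1.
  case: hx => hx; [right|left]; first by rewrite lef_pV2.
  by rewrite -[h]invrK lef_pV2// posrE invr_gt0.
have := ler_wpM2r (ltW x0) (small _ _ k01 w0 hw).
rewrite powRVl; last exact: ltW.
rewrite (@powRB _ x 1 nu) ?(gt_eqF x0) ?implybT// powRr1 ?(ltW x0)//.
have p0 : x `^ nu != 0 by rewrite gt_eqF ?powR_gt0.
have -> : specht (h `^ (1 - nu)) / (x / x `^ nu) * x =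
  specht (h `^ (1 - nu)) * x `^ nu by field; rewrite p0 gt_eqF.
have -> : (1 - (1 - nu) + (1 - nu) / x) * x = 1 - nu + nu * x by field; rewrite gt_eqF.
by [].
Qed.

End Specht.

(** * Uniform polynomial approximation *)

Section Weierstrass.
Variable R : realType.
Implicit Types (f : R -> R) (phi : nat -> R) (x a b c e : R).

(* Pascal's rule, so that [bernstein n phi] is the polynomial
   [\sum_k 'C(n, k) 'X^k (1 - 'X)^(n - k) phi k]. *)
Fixpoint bernstein (n : nat) phi : {poly R} :=
  if n is n'.+1 then
    (1 - 'X) * bernstein n' phi + 'X * bernstein n' (fun k => phi k.+1)
  else (phi 0%N)%:P.

Lemma bernsteinN n phi : bernstein n (fun k => - phi k) = - bernstein n phi.
Proof.
elim: n phi => [|n IH] phi /=; first by rewrite polyCN.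
by rewrite !IH !mulrN opprD.
Qed.

(** The right-hand side is the expectation of [a + b (k - c)^2] for [k] binomial with parameters [n]
    and [x]: variance plus squared bias. In the induction, the shifted branch replaces [c] by
    [c - 1]. *)
Lemma bernstein_le n phi a b c x : 0 <= x <= 1 ->
  (forall k, (k <= n)%N -> phi k <= a + b * (k%:R - c) ^+ 2) ->
  (bernstein n phi).[x] <= a + b * (n%:R * (x * (1 - x)) + (n%:R * x - c) ^+ 2).
Proof.
move=> /andP[x0 x1]; elim: n phi c => [|n IH] phi c phile /=.
  rewrite hornerC; have := phile 0%N isT; by rewrite mulr0n !mul0r !add0r.
rewrite hornerD !hornerM hornerD hornerN hornerX hornerC; have x1' : 0 <= 1 - x by lra.
have h1 := IH phi c (fun k kn => phile k (leqW kn)).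
have h2 := IH (fun k => phi k.+1) (c - 1).
apply: le_trans (lerD (ler_wpM2l x1' h1) (ler_wpM2l x0 (h2 _))) _.
  move=> k kn; have := phile k.+1 kn; rewrite -natr1.
  by rewrite (_ : k%:R + 1 - c = k%:R - (c - 1)); last ring.
by rewrite -natr1 le_eqVlt; apply/orP; left; apply/eqP; ring.
Qed.

(** Heine-Cantor: each point has a ball and a threshold on [d] that work together, and compactness
    of the segment makes the threshold common. *)
Lemma unif_continuous_segment f a b :
  (forall x, a <= x <= b -> {for x, continuous f}) -> forall e, 0 < e ->
  exists2 d, 0 < d & forall x y, a <= x <= b -> a <= y <= b ->
    `|x - y| < d -> `|f x - f y| < e.
Proof.
move=> cf e e0.
have /compact_near_coveringP/(_ _ (0^'+) (fun d x => forall y, `|x - y| < d ->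
   `|f x - f y| < e)) := @segment_compact R a b.
case=> [x|].
  rewrite /= in_itv /= => xab.
  have e2 : 0 < e / 2 by lra.
  have /cvgrPdist_lt/(_ _ e2)/nbhs_ballP[d /= d0 fd] := cf x xab.
  have d2 : 0 < d / 2 by lra.
  exists (ball x (d / 2), [set k | k < d / 2]); first split => /=.
    exact: nbhsx_ballx.
    exact: nbhs_right_lt.
  move=> [x' d'] /= [xx' dd'] y x'y.
  have h1 : `|f x - f x'| < e / 2.
    by apply: fd; rewrite /ball /= in xx' *; lra.
  have h2 : `|f x - f y| < e / 2.
    apply: fd; rewrite /ball /= in xx' *.
    by apply: le_lt_trans (ler_distD x' _ _) _; lra.
  by apply: le_lt_trans (ler_distD (f x) _ _) _; rewrite distrC; lra.
move=> d /= d0 H; exists (d / 2); first by lra.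
move=> x y xab _; apply: (H (d / 2)); rewrite ?in_itv//=; last lra.
by rewrite sub0r normrN gtr0_norm; lra.
Qed.

(** Puts continuity in the form that [bernstein_le] accepts. Points closer than [d] are handled by
    uniform continuity; for the others [(x - y)^2 / d^2 >= 1], so the oscillation of [f] over [d^2]
    serves as [L]. *)
Lemma quadratic_modulus f a b : a <= b ->
  (forall x, a <= x <= b -> {for x, continuous f}) -> forall e, 0 < e ->
  exists2 L, 0 <= L & forall x y, a <= x <= b -> a <= y <= b ->
    f x <= f y + e + L * (x - y) ^+ 2.
Proof.
move=> ab cf e e0; have [d d0 fd] := unif_continuous_segment cf e0.
have cf' : {within `[a, b], continuous f}.
  apply: continuous_in_subspaceT => x; rewrite inE/= in_itv/=; exact: cf.
have [c1 _ f1] := EVT_max ab cf'.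
have [c2 _ f2] := EVT_min ab cf'.
have dd : 0 < d ^+ 2 by rewrite exprn_gt0.
have K0 : 0 <= `|f c1 - f c2| / d ^+ 2 by rewrite divr_ge0// ltW.
exists (`|f c1 - f c2| / d ^+ 2) => // x y xab yab.
have sq : 0 <= `|f c1 - f c2| / d ^+ 2 * (x - y) ^+ 2.
  by rewrite mulr_ge0// sqr_ge0.
have [xy|xy] := ltP `|x - y| d.
  by have := ler_norm (f x - f y); have := fd _ _ xab yab xy; lra.
have h : `|f c1 - f c2| <= `|f c1 - f c2| / d ^+ 2 * (x - y) ^+ 2.
  rewrite mulrAC ler_pdivlMr// ler_wpM2l//.
  by rewrite -[leRHS]real_normK ?num_real// lerXn2r ?nnegrE//; lra.
have := f1 x; have := f2 y; rewrite !in_itv /= => /(_ yab) h2 /(_ xab) h1.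
by have := ler_norm (f c1 - f c2); lra.
Qed.

Lemma weierstrass01 f :
  (forall x, 0 <= x <= 1 -> {for x, continuous f}) -> forall e, 0 < e ->
  exists p : {poly R}, forall x, 0 <= x <= 1 -> `|p.[x] - f x| <= e.
Proof.
move=> cf e e0; have e2 : 0 < e / 2 by lra.
have [L L0 fL] := quadratic_modulus ler01 cf e2.
(* Centring at [c = n x] removes the bias, and the variance contributes at most [L / n], which this
   [n] makes at most [e / 2]. *)
pose n := (Num.truncn (L / (e / 2))).+1.
have nL : L <= n%:R * (e / 2).
  by rewrite -ler_pdivrMr// ltW// truncnS_gt.
have n0 : 0 < (n%:R : R) by rewrite ltr0n.
exists (bernstein n (fun k => f (k%:R / n%:R))) => x x01.
have kn01 k : (k <= n)%N -> 0 <= (k%:R / n%:R : R) <= 1.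
  by move=> kn; rewrite divr_ge0//= ler_pdivrMr// mul1r ler_nat.
pose B := L / n%:R ^+ 2.
have B0 : 0 <= B by rewrite divr_ge0// exprn_ge0// ltW.
have BE k : L * (k%:R / n%:R - x) ^+ 2 = B * (k%:R - n%:R * x) ^+ 2.
  by rewrite /B; field; rewrite gt_eqF.
have Bx : B * (n%:R * (x * (1 - x)) + (n%:R * x - n%:R * x) ^+ 2) <= e / 2.
  have -> : B * (n%:R * (x * (1 - x)) + (n%:R * x - n%:R * x) ^+ 2) = L / n%:R * (x * (1 - x)).
    by rewrite /B; field; rewrite gt_eqF.
  have h1 : L / n%:R <= e / 2 by rewrite ler_pdivrMr// mulrC.
  have h2 : x * (1 - x) <= 1 by nra.
  apply: le_trans (ler_pM _ _ h1 h2) _; rewrite ?divr_ge0 ?(ltW n0)//; nra.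
have U := @bernstein_le n (fun k => f (k%:R / n%:R)) (f x + e / 2) B (n%:R * x) x x01.
(* The lower bound is the upper bound for [- f]. *)
have V := @bernstein_le n (fun k => - f (k%:R / n%:R)) (- f x + e / 2) B (n%:R * x) x x01.
rewrite bernsteinN hornerN in V.
rewrite ler_norml; apply/andP; split.
  suff : forall k, (k <= n)%N -> - f (k%:R / n%:R) <= - f x + e / 2 + B * (k%:R - n%:R * x) ^+ 2.
    move=> /V; lra.
  move=> k kn; rewrite -BE -sqrrN opprB.
  have := fL _ _ x01 (kn01 k kn); lra.
suff : (bernstein n (fun k => f (k%:R / n%:R))).[x] <= f x + e / 2 +
  B * (n%:R * (x * (1 - x)) + (n%:R * x - n%:R * x) ^+ 2) by lra.
by apply: U => k kn; rewrite -BE fL// kn01.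
Qed.

Lemma weierstrass f a b :
  (forall x, a <= x <= b -> {for x, continuous f}) -> forall e, 0 < e ->
  exists p : {poly R}, forall x, a <= x <= b -> `|p.[x] - f x| <= e.
Proof.
move=> cf e e0; have [ba|ab] := ltP b a.
  by exists 0 => x; lra.
have [->|/eqP aNb] := eqVneq a b.
  exists (f b)%:P => x xb; have -> : x = b by lra.
  by rewrite hornerC subrr normr0 ltW.
have {}ab : 0 < b - a by lra.
pose g s := f (a + s * (b - a)).
have [|p pg] := @weierstrass01 g _ _ e0.
  move=> s s01; rewrite /g; apply: continuous_comp.
    by apply: cvgD; [exact: cvg_cst|apply: cvgM; [exact: cvg_id|exact: cvg_cst]].
  by apply: cf; nra.
exists (p \Po ((b - a)^-1 *: ('X - a%:P))) => x xab.
have xE : a + (x - a) / (b - a) * (b - a) = x by field; rewrite gt_eqF.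
rewrite horner_comp hornerZ hornerXsubC mulrC.
have := pg ((x - a) / (b - a)); rewrite /g xE; apply.
by rewrite divr_ge0 ?(ltW ab) ?ler_pdivrMr//=; lra.
Qed.

End Weierstrass.

(** * The real inner product *)

Section Complex.
Variable R : rcfType.
Implicit Types (z w : R[i]) (a : R).

Lemma complex_ReD z w : complex.Re (z + w) = complex.Re z + complex.Re w.
Proof. by case: z; case: w. Qed.

Lemma complex_ReN z : complex.Re (- z) = - complex.Re z.
Proof. by case: z. Qed.

Lemma complex_ReZ a z : complex.Re (a%:C * z) = a * complex.Re z.
Proof. by case: z => u v /=; rewrite mul0r subr0. Qed.

Lemma complex_Re_mul_i z : complex.Re ('i%C * z) = - complex.Im z.
Proof. by case: z => u v /=; rewrite mul0r mul1r sub0r. Qed.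

Lemma complex_Re_conj z : complex.Re (Num.conj z) = complex.Re z.
Proof. by case: z => u v; reflexivity. Qed.

Lemma complex_Im_conj z : complex.Im (Num.conj z) = - complex.Im z.
Proof. by case: z => u v; reflexivity. Qed.

End Complex.

Section Hilbert.
Variables (R : realType) (H : completeNormedModType R[i]).
Variable ip : {dot H for @Num.conj R[i]}.
Hypothesis ip_normE : ip_norm ip.
Implicit Types (x y z : H) (T X Y : H -> H) (a b c : R).

(** Norm and inner product take values in [R[i]]; estimates are made in [R] instead. The imaginary
    part of [ip x y] remains accessible through [rip ('i *: x) y]. *)
Definition nrm x : R := complex.Re `|x|.
Definition rip x y : R := complex.Re (ip x y).

Lemma nrmE x : `|x| = (nrm x)%:C.
Proof. by rewrite /nrm RRe_real// ger0_real. Qed.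

Lemma nrm_ge0 x : 0 <= nrm x.
Proof. by rewrite -ler0c -nrmE. Qed.

Lemma nrm_eq0 x : (nrm x == 0) = (x == 0).
Proof. by rewrite -(inj_eq (@complexI R)) -nrmE normr_eq0. Qed.

Lemma nrmD x y : nrm (x + y) <= nrm x + nrm y.
Proof. by rewrite -lecR rmorphD/= -!nrmE ler_normD. Qed.

Lemma nrmN x : nrm (- x) = nrm x.
Proof. by rewrite /nrm normrN. Qed.

Lemma nrmB x y : nrm (x - y) = nrm (y - x).
Proof. by rewrite -nrmN opprB. Qed.

Lemma nrmZ a x : nrm (a%:C *: x) = `|a| * nrm x.
Proof.
apply: (@complexI R); rewrite -nrmE normrZ nrmE rmorphM/=; congr (_ * _).
by rewrite normc_def/= expr0n addr0 sqrtr_sqr.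
Qed.

Lemma nrm_sqr x : nrm x ^+ 2 = rip x x.
Proof. by rewrite /rip -ip_normE nrmE -rmorphXn; reflexivity. Qed.

Lemma ripC x y : rip x y = rip y x.
Proof. by rewrite /rip hermC expr0 mul1r complex_Re_conj. Qed.

Lemma ripDl x y z : rip (x + y) z = rip x z + rip y z.
Proof. by rewrite /rip linearDl complex_ReD. Qed.

Lemma ripZl a x y : rip (a%:C *: x) y = a * rip x y.
Proof. by rewrite /rip linearZl_LR complex_ReZ. Qed.

Lemma ripNl x y : rip (- x) y = - rip x y.
Proof. by rewrite /rip linearNl complex_ReN. Qed.

Lemma ripDr x y z : rip x (y + z) = rip x y + rip x z.
Proof. by rewrite ripC ripDl !(ripC _ x). Qed.

Lemma ripZr a x y : rip x (a%:C *: y) = a * rip x y.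
Proof. by rewrite ripC ripZl ripC. Qed.

Lemma ripNr x y : rip x (- y) = - rip x y.
Proof. by rewrite ripC ripNl ripC. Qed.

Lemma ripiE x y : rip ('i *: x) y = - complex.Im (ip x y).
Proof. by rewrite /rip linearZl_LR complex_Re_mul_i. Qed.

Lemma ripi x y : rip ('i *: x) y = - rip x ('i *: y).
Proof. by rewrite ripiE (ripC x) ripiE hermC expr0 mul1r complex_Im_conj. Qed.

(** Square the triangle inequality, which comes with the normed space [H], and keep the cross
    terms. *)
Lemma cauchy_schwarz x y : rip x y <= nrm x * nrm y.
Proof.
have : nrm (x + y) ^+ 2 <= (nrm x + nrm y) ^+ 2.
  by rewrite lerXn2r ?nnegrE ?addr_ge0 ?nrm_ge0// nrmD.
by rewrite sqrrD !nrm_sqr ripDl !ripDr (ripC y x); lra.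
Qed.

Lemma bounded_opP T :
  bounded_op T <-> linear T /\ exists2 c, 0 < c & forall x, nrm (T x) <= c * nrm x.
Proof.
split=> -[linT].
  pose T' : {linear H -> H} := HB.pack T (GRing.isLinear.Build _ _ _ _ T linT).
  have -> : T = T' by [].
  move=> /linear_bounded_continuous/linear_boundedP/pinfty_ex_gt0[c c0 Tc].
  split=> //; have cE : c = (complex.Re c)%:C by rewrite RRe_real// gtr0_real.
  exists (complex.Re c); first by rewrite -ltcR -cE.
  by move=> x; rewrite -lecR rmorphM/= -cE -!nrmE.
pose T' : {linear H -> H} := HB.pack T (GRing.isLinear.Build _ _ _ _ T linT).
move=> [c c0 Tc]; split=> //.
apply/(@linear_bounded_continuous _ _ _ T')/linear_boundedP.
near=> M => x; rewrite (@le_trans _ _ (c%:C * `|x|))//.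
  by rewrite !nrmE -rmorphM lecR Tc.
rewrite ler_wpM2r//; near: M; apply: nbhs_pinfty_ge; by apply/complex_realP; exists c.
Unshelve. all: by end_near. Qed.

Lemma cauchy_limit (u : nat -> H) :
  (forall e : R, 0 < e -> exists n0, forall n m, (n0 <= n)%N -> (n0 <= m)%N ->
     nrm (u n - u m) <= e) ->
  exists l, forall e : R, 0 < e -> exists n0, forall n, (n0 <= n)%N ->
     nrm (u n - l) <= e.
Proof.
move=> uC; have : cvgn u.
  apply/cauchy_cvgP/cauchy_ballP => e e0; near_simpl.
  have eE : e = (complex.Re e)%:C by rewrite RRe_real// gtr0_real.
  have e0' : 0 < complex.Re e by rewrite -ltcR -eE.
  have [|n0 un] := uC (complex.Re e / 2); first by rewrite divr_gt0.
  exists ([set n | (n0 <= n)%N], [set n | (n0 <= n)%N]).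
    by split; exists n0.
  move=> [n m] /= [nn nm]; rewrite -ball_normE/= nrmE eE ltcR.
  by apply: le_lt_trans (un n m nn nm) _; lra.
move=> uc; exists (limn u) => e e0.
have e0' : 0 < e%:C by rewrite ltcR.
have /cvgrPdist_le/(_ _ e0')[n0 _ un] := uc.
by exists n0 => n /un; rewrite nrmE lecR nrmB.
Qed.

End Hilbert.

(** * Invertible operators *)

Section Invertible.
Variables (R : realType) (H : completeNormedModType R[i]).
Implicit Types (x y z : H) (S T U V X Y : H -> H) (a b c e : R) (w : R[i]).

(** Turns estimates that hold up to an arbitrarily small error into exact ones. The [c + 1] in the
    test value allows [c = 0]. *)
Lemma le0_eps a c : 0 <= c -> (forall e, 0 < e -> a <= c * e) -> a <= 0.
Proof.
move=> c0 ae; rewrite leNgt; apply/negP => a0.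
have := ae (a / (2 * (c + 1))); rewrite divr_gt0//; last lra.
move=> /(_ isT); rewrite mulrA ler_pdivlMr; last lra.
nra.
Qed.

Lemma eq_eps x y c : 0 <= c -> (forall e, 0 < e -> nrm (x - y) <= c * e) -> x = y.
Proof.
move=> c0 /(le0_eps c0) xy; apply/eqP; rewrite -subr_eq0 -nrm_eq0.
by rewrite eq_le xy nrm_ge0.
Qed.

Lemma nrm_dist z x y : nrm (x - y) <= nrm (x - z) + nrm (y - z).
Proof. by rewrite (nrmB y z) -(subrKA z); exact: nrmD. Qed.

Lemma linear_pack T : linear T -> exists T' : {linear H -> H}, T = T'.
Proof.
move=> linT.
pose T' : {linear H -> H} := HB.pack T (GRing.isLinear.Build _ _ _ _ T linT).
by exists T'.
Qed.

Lemma bounded_op_id : bounded_op (id : H -> H).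
Proof. by apply/bounded_opP; split=> //; exists 1 => // x; rewrite mul1r. Qed.

Lemma bounded_opD S T : bounded_op S -> bounded_op T -> bounded_op (S + T).
Proof.
move=> /bounded_opP[linS [c c0 Sc]] /bounded_opP[linT [d d0 Td]].
apply/bounded_opP; split.
  by move=> w x y; rewrite !fctE linS linT scalerDr addrACA.
exists (c + d); first exact: addr_gt0.
by move=> x; rewrite mulrDl; apply: le_trans (nrmD _ _) _; rewrite lerD.
Qed.

Lemma bounded_opZ w T : bounded_op T -> bounded_op (w *: T).
Proof.
move=> /bounded_opP[linT [c c0 Tc]]; apply/bounded_opP; split.
  by move=> v x y; rewrite !fctE linT scalerDr !scalerA mulrC.
have w0 : 0 <= complex.Re `|w|.
  by rewrite -ler0c RRe_real// ger0_real.
(* The [+ 1] keeps the constant positive when [w = 0]. *)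
exists ((complex.Re `|w| + 1) * c); first by rewrite mulr_gt0//; lra.
move=> x; rewrite !fctE.
have -> : nrm (w *: T x) = complex.Re `|w| * nrm (T x).
  by rewrite /nrm normrZ -[`|w|]RRe_real ?ger0_real// complex_ReZ.
rewrite -mulrA; have := Tc x; have := nrm_ge0 (T x); nra.
Qed.

Lemma bounded_opN T : bounded_op T -> bounded_op (- T).
Proof. by move=> bT; rewrite -scaleN1r; exact: bounded_opZ. Qed.

Lemma bounded_op_comp S T : bounded_op S -> bounded_op T -> bounded_op (S \o T).
Proof.
move=> /bounded_opP[linS [c c0 Sc]] /bounded_opP[linT [d d0 Td]].
apply/bounded_opP; split; first by move=> w x y /=; rewrite linT linS.
exists (c * d); first exact: mulr_gt0.
by move=> x /=; apply: le_trans (Sc _) _; rewrite -mulrA ler_pM2l.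
Qed.

Definition invertible T : Prop := exists Y, is_inverse T Y.

Lemma invertible_comp S T : invertible S -> invertible T -> invertible (S \o T).
Proof.
move=> [X [bX SX XS]] [Y [bY TY YT]]; exists (Y \o X).
split; first exact: bounded_op_comp.
  by rewrite -compA (compA T) TY.
by rewrite -compA (compA X) XS.
Qed.

Lemma invertibleZ w T : bounded_op T -> w != 0 -> invertible T -> invertible (w *: T).
Proof.
move=> [/linear_pack[T' ->] _] w0 [Y [bY TY YT]]; exists (w^-1 *: Y).
split; first exact: bounded_opZ.
  by apply/funext => x; rewrite /= !fctE linearZ scalerA mulfV// scale1r; exact: (congr1 (@^~ x) TY).
case: bY => /linear_pack[Y' YE] _; rewrite YE in YT *.
by apply/funext => x; rewrite /= !fctE linearZ scalerA mulVf// scale1r; exact: (congr1 (@^~ x) YT).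
Qed.

Lemma inverse_unique T X Y : is_inverse T X -> is_inverse T Y -> X = Y.
Proof.
move=> [_ _ XT] [_ TY _]; transitivity (X \o (T \o Y)); first by rewrite TY.
by rewrite compA XT.
Qed.

Lemma op_inv_eq T Y : is_inverse T Y -> op_inv T = Y.
Proof.
move=> TY; apply: (inverse_unique _ TY).
by apply: (@xgetPex _ 0 [set X | is_inverse T X]); exists Y.
Qed.

End Invertible.

(** * Coercivity and the spectrum of a symmetric operator *)

Section Coercive.
Variables (R : realType) (H : completeNormedModType R[i]).
Variable ip : {dot H for @Num.conj R[i]}.
Hypothesis ip_normE : ip_norm ip.
Implicit Types (x y z : H) (S T X Y : H -> H) (a b c t l : R) (w : R[i]).

(* Richardson iteration: for small [s] the map [x |-> x - s (T x - y)] is a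
   contraction. *)
Lemma coercive_surj T c : bounded_op T -> 0 < c ->
  (forall x, c * nrm x ^+ 2 <= rip ip (T x) x) -> forall y, exists x, T x = y.
Proof.
move=> /bounded_opP[/linear_pack[T' ->] [C' C'0 TC']] c0 Tc y.
(* The bound is enlarged so that [c / C] lies strictly between 0 and 1. *)
pose C := C' + c; have C0 : 0 < C by rewrite addr_gt0.
have cC : c < C by rewrite /C; lra.
have TC x : nrm (T' x) <= C * nrm x.
  by apply: le_trans (TC' x) _; rewrite ler_wpM2r ?nrm_ge0// /C; lra.
(* This [s] minimises [1 - 2 s c + s^2 C^2], a bound for the squared contraction factor; the minimum
   is [q^2 = 1 - (c / C)^2]. *)
pose s := c / C ^+ 2; have s0 : 0 < s by rewrite divr_gt0// exprn_gt0.
pose q := Num.sqrt (1 - (c / C) ^+ 2).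
have cC1 : 0 < c / C < 1 by rewrite divr_gt0// ltr_pdivrMr// mul1r.
have q1 : q < 1 by rewrite /q -[ltRHS]sqrtr1 ltr_sqrt//; nra.
have q0 : 0 <= q := sqrtr_ge0 _.
have qE : q ^+ 2 = 1 - (c / C) ^+ 2 by rewrite sqr_sqrtr//; nra.
have contr x : nrm (x - s%:C *: T' x) <= q * nrm x.
  rewrite -(@ler_pXn2r _ 2)// ?nnegrE ?mulr_ge0 ?nrm_ge0// exprMn qE.
  rewrite (nrm_sqr ip_normE) ripDl !ripDr !ripNl !ripNr !ripZl !ripZr -!(nrm_sqr ip_normE).
  rewrite (ripC _ x (T' x)).
  have h1 := ler_wpM2l (ltW s0) (Tc x).
  have h2 : s ^+ 2 * nrm (T' x) ^+ 2 <= s ^+ 2 * (C ^+ 2 * nrm x ^+ 2).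
    rewrite ler_wpM2l ?sqr_ge0// -exprMn lerXn2r ?nnegrE ?nrm_ge0//.
    by rewrite mulr_ge0 ?nrm_ge0// ltW.
  have E1 : s ^+ 2 * (C ^+ 2 * nrm x ^+ 2) = (c / C) ^+ 2 * nrm x ^+ 2.
    by rewrite /s; field; rewrite gt_eqF.
  have E2 : s * (c * nrm x ^+ 2) = (c / C) ^+ 2 * nrm x ^+ 2.
    by rewrite /s; field; rewrite gt_eqF.
  rewrite E1 in h2; rewrite E2 in h1; nra.
pose u n := iter n (fun x => x - s%:C *: (T' x - y)) 0.
have uS n : u n.+1 = u n - s%:C *: (T' (u n) - y) by [].
have incr n : u n.+1 - u n = - (s%:C *: (T' (u n) - y)) by rewrite uS addrC addKr.
pose D := nrm (u 1%N - u 0%N).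
have step n : nrm (u n.+1 - u n) <= q ^+ n * D.
  elim: n => [|n IH]; first by rewrite expr0 mul1r.
  have -> : u n.+2 - u n.+1 = (u n.+1 - u n) - s%:C *: T' (u n.+1 - u n).
    rewrite (linearB T') {1}(incr n) incr -opprD -scalerDr; congr (- (_ *: _)).
    by rewrite [RHS]addrC addrA subrK.
  by apply: le_trans (contr _) _; rewrite exprS -mulrA ler_wpM2l.
have D0 : 0 <= D by exact: nrm_ge0.
(* Each step [q^n D] equals [(q^n - q^(n+1)) E], so the sum of the steps telescopes. *)
pose E := D / (1 - q); have E0 : 0 <= E by rewrite divr_ge0//; lra.
have dist n k : nrm (u (k + n)%N - u n) <= (q ^+ n - q ^+ (k + n)) * E.
  elim: k => [|k IH]; first by rewrite add0n !subrr mul0r /nrm normr0.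
  have -> : u (k.+1 + n)%N - u n = (u (k + n).+1 - u (k + n)%N) + (u (k + n)%N - u n).
    by rewrite addrA subrK.
  apply: le_trans (nrmD _ _) _; apply: le_trans (lerD (step _) IH) _.
  have -> : D = (1 - q) * E by rewrite /E; field; lra.
  by rewrite addSn exprS le_eqVlt; apply/orP; left; apply/eqP; ring.
have [e e0|l ul] := @cauchy_limit _ _ u.
  have [n0 qn0] : exists n0, q ^+ n0 * E <= e / 2.
    have : q ^+ n * E @[n --> \oo] --> 0 * E.
      by apply: cvgM; [apply: cvg_expr; rewrite ger0_norm|exact: cvg_cst].
    rewrite mul0r => /cvgrPdist_le/(_ (e / 2))[|n0 _ /(_ n0 (leqnn _))]; first by lra.
    rewrite sub0r normrN /= => h; exists n0; apply: le_trans h; exact: ler_norm.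
  have near n : (n0 <= n)%N -> nrm (u n - u n0) <= e / 2.
    move=> /subnK <-; apply: le_trans (dist _ _) (le_trans _ qn0).
    by rewrite ler_wpM2r// lerBlDr lerDl exprn_ge0.
  exists n0 => n m nn nm; apply: le_trans (nrm_dist (u n0) _ _) _.
  by have := near n nn; have := near m nm; lra.
exists l; apply: (@eq_eps _ _ _ _ (C + 2 / s)).
  by rewrite addr_ge0 ?(ltW C0)// divr_ge0 ?(ltW s0).
move=> e e0; have [n0 un0] := ul e e0.
have h1 := un0 n0 (leqnn _); have h2 := un0 n0.+1 (leqnSn _).
(* The residual [T u_n - y] is [s^-1 (u_n - u_(n+1))], which tends to 0. *)
have -> : T' l - y = - T' (u n0 - l) + (s^-1)%:C *: (u n0 - u n0.+1).
  rewrite uS subKr scalerA -rmorphM/= mulVf ?gt_eqF// scale1r.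
  by rewrite (linearB T') opprB addrA subrK.
apply: le_trans (nrmD _ _) _; rewrite nrmN nrmZ gtr0_norm ?invr_gt0//.
have h3 : nrm (u n0 - u n0.+1) <= 2 * e.
  by apply: le_trans (nrm_dist l _ _) _; lra.
have h4 : s^-1 * nrm (u n0 - u n0.+1) <= s^-1 * (2 * e).
  by rewrite ler_pM2l ?invr_gt0.
have h5 : C * nrm (u n0 - l) <= C * e by rewrite ler_pM2l.
have -> : (C + 2 / s) * e = C * e + s^-1 * (2 * e) by ring.
exact: lerD (le_trans (TC _) h5) h4.
Qed.

(** By Cauchy-Schwarz [c |x| <= |T x|]. This gives injectivity, from which the pointwise chosen
    inverse is linear, and bounds that inverse by [c^-1]. *)
Lemma coercive_invertible T c : bounded_op T -> 0 < c ->
  (forall x, c * nrm x ^+ 2 <= rip ip (T x) x) -> invertible T.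
Proof.
move=> bT c0 Tc; have [Y TY] := choice (coercive_surj bT c0 Tc).
case: (bT) => /linear_pack[T' TE] _.
have low x : c * nrm x <= nrm (T x).
  have [->|x0] := eqVneq x 0; first by rewrite {1}/nrm normr0 mulr0 nrm_ge0.
  have {}x0 : 0 < nrm x by rewrite lt_neqAle eq_sym nrm_eq0 x0 nrm_ge0.
  rewrite -(ler_pM2r x0) -mulrA -expr2; apply: le_trans (Tc x) _.
  exact: cauchy_schwarz.
have injT x y : T x = T y -> x = y.
  move=> xy; apply/eqP; rewrite -subr_eq0 -nrm_eq0 eq_le nrm_ge0 andbT.
  have := low (x - y); rewrite TE linearB -TE xy subrr {2}/nrm normr0.
  by rewrite pmulr_rle0.
exists Y; split; [|exact/funext|by apply/funext => x; apply: injT; rewrite /= TY].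
apply/bounded_opP; split.
  by move=> w x y; apply: injT; rewrite TY TE linearP -TE !TY.
exists c^-1 => [|x]; first by rewrite invr_gt0.
by rewrite -(ler_pM2l c0) mulrA mulfV ?gt_eqF// mul1r -{2}(TY x).
Qed.

(** Comparing real parts is enough: for a complex linear [T], replacing [x] by ['i *: x] yields the
    imaginary parts, so this is self-adjointness. *)
Definition symmetric_op T : Prop := forall x y, rip ip (T x) y = rip ip x (T y).

(** The vectors [x] and ['i *: x] are orthogonal for [rip], so [complex.Im w] drops out. *)
Lemma rip_scaler T w x : rip ip ((T - w *: id) x) x =
  rip ip (T x) x - complex.Re w * nrm x ^+ 2.
Proof.
rewrite !fctE ripDl ripNl; congr (_ - _).
rewrite {1}(complexE w) scalerDl ripDl ripZl (nrm_sqr ip_normE) -scalerA ripi.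
suff -> : rip ip ((complex.Im w)%:C *: x) ('i *: x) = 0 by rewrite oppr0 addr0.
rewrite ripZl; suff -> : rip ip x ('i *: x) = 0 by rewrite mulr0.
have := ripi ip x x; rewrite (ripC ip ('i *: x)); lra.
Qed.

(** After multiplication by [i Im w], the term in [T] has zero real part and the term in [w]
    contributes [(Im w)^2 |x|^2], so the operator becomes coercive. *)
Lemma symmetric_nonreal T w : bounded_op T -> symmetric_op T ->
  complex.Im w != 0 -> invertible (T - w *: id).
Proof.
move=> bT sT w0; set S := T - _.
have bS : bounded_op S.
  by apply: bounded_opD => //; apply/bounded_opN/bounded_opZ/bounded_op_id.
pose v : R[i] := (complex.Im w)%:C * 'i.
have v0 : v != 0.
  apply: mulf_neq0; last by rewrite eq_complex/= oner_eq0 andbF.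
  by apply: contraNneq w0 => /(congr1 (@complex.Re R))/= ->.
have : invertible (v *: S).
  apply: (@coercive_invertible _ (complex.Im w ^+ 2)); first exact: bounded_opZ.
    by rewrite exprn_even_gt0.
  move=> x; rewrite !fctE /v -scalerA ripZl scalerBr ripDl ripNl.
  suff [-> ->] : rip ip ('i *: T x) x = 0 /\
     rip ip ('i *: (w *: x)) x = - complex.Im w * nrm x ^+ 2 by nra.
  split.
    have := ripi ip (T x) x; rewrite sT.
    have [/linear_pack[T' TE] _] := bT.
    by rewrite TE linearZ/= -TE (ripC ip x); lra.
  have := rip_scaler 0 ('i * w) x; rewrite !fctE sub0r ripNl scalerA complex_Re_mul_i.
  by rewrite /rip linear0l/=; lra.
move=> /(invertibleZ (bounded_opZ v bS) (invr_neq0 v0)).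
by rewrite scalerA mulVf// scale1r.
Qed.

(** For [t < a] the operator [T - t] is coercive, and for [t > b] its opposite is. *)
Lemma spectrum_bounds T a b t : bounded_op T ->
  (forall x, a * nrm x ^+ 2 <= rip ip (T x) x <= b * nrm x ^+ 2) ->
  spectrum T t%:C -> a <= t <= b.
Proof.
move=> bT Tab nT; set S := T - t%:C *: (id : H -> H).
have bS : bounded_op S.
  by apply: bounded_opD => //; apply/bounded_opN/bounded_opZ/bounded_op_id.
apply/andP; split; rewrite leNgt; apply/negP => tab; apply: nT.
  apply: (@coercive_invertible _ (a - t)) => //; first by rewrite subr_gt0.
  by move=> x; rewrite rip_scaler/=; have /andP[] := Tab x; lra.
have : invertible (-1 *: S).
  apply: (@coercive_invertible _ (t - b)); first exact: bounded_opZ.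
    by rewrite subr_gt0.
  move=> x; rewrite fctE scaleN1r ripNl rip_scaler/=.
  by have /andP[] := Tab x; lra.
have m1 : -1 != 0 :> R[i] by rewrite oppr_eq0 oner_eq0.
move=> /(invertibleZ (bounded_opZ _ bS) m1).
by rewrite scalerA mulrNN mulr1 scale1r.
Qed.

Lemma symmetric_shift T a : symmetric_op T -> symmetric_op (T - a%:C *: id).
Proof.
by move=> sT x y; rewrite !fctE ripDl ripDr ripNl ripNr ripZl ripZr sT.
Qed.

(** Expand the positivity of [S] at the vector [x - c^-1 S x] and bound [<S S x, S x>] by
    [c |S x|^2]. *)
Lemma positive_sqr_le S c : bounded_op S -> symmetric_op S ->
  (forall x, 0 <= rip ip (S x) x) -> 0 < c -> (forall x, nrm (S x) <= c * nrm x) ->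
  forall x, nrm (S x) ^+ 2 <= c * rip ip (S x) x.
Proof.
move=> [/linear_pack[S' ->] _] sS S0 c0 Sc x.
have := S0 (x - (c^-1)%:C *: S' x).
rewrite (linearB S') linearZ/= ripDl !ripDr !ripNl !ripNr !ripZl !ripZr.
rewrite (sS (S' x) x) -(nrm_sqr ip_normE).
have h : rip ip (S' (S' x)) (S' x) <= c * nrm (S' x) ^+ 2.
  apply: le_trans (cauchy_schwarz ip_normE _ _) _.
  by rewrite expr2 mulrA ler_wpM2r ?nrm_ge0.
have cV : 0 < c^-1 by rewrite invr_gt0.
have {}h : c^-1 * (c^-1 * rip ip (S' (S' x)) (S' x)) <= c^-1 * nrm (S' x) ^+ 2.
  by rewrite ler_pM2l// ler_pdivrMl.
move=> h1; have {h1}h2 : c^-1 * nrm (S' x) ^+ 2 <= rip ip (S' x) x by lra.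
by rewrite -ler_pdivrMl.
Qed.

(** Take for [l] the largest lower bound of the quadratic form; it is finite because [x0] is
    nonzero. If [S = T - l] had an inverse bounded by [D], then
    [|x|^2 <= D^2 |S x|^2 <= D^2 K <S x, x>] with [K] a bound of [S], so [l + (D^2 K)^-1] would
    still be a lower bound. *)
Lemma symmetric_lower_bound T x0 : bounded_op T -> symmetric_op T -> x0 != 0 ->
  exists2 l, forall x, l * nrm x ^+ 2 <= rip ip (T x) x &
    ~ invertible (T - l%:C *: id).
Proof.
move=> bT sT x0N; pose E := [set l | forall x, l * nrm x ^+ 2 <= rip ip (T x) x].
have /bounded_opP[_ [C C0 TC]] := bT.
have npos x : x != 0 -> 0 < nrm x ^+ 2.
  by move=> xN; rewrite exprn_gt0// lt_neqAle eq_sym nrm_eq0 xN nrm_ge0.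
have EC : E (- C).
  move=> x; have := cauchy_schwarz ip_normE (- T x) x; rewrite ripNl nrmN => h.
  have : nrm (T x) * nrm x <= C * nrm x ^+ 2.
    by rewrite expr2 mulrA ler_wpM2r ?nrm_ge0.
  by lra.
have ubE x : x != 0 -> ubound E (rip ip (T x) x / nrm x ^+ 2).
  by move=> xN k Ek; rewrite ler_pdivlMr ?npos.
have hsE : has_sup E by split; [exists (- C)|exists (rip ip (T x0) x0 / nrm x0 ^+ 2); exact: ubE].
have supE : E (sup E).
  move=> x.
  have [->|xN] := eqVneq x 0; first by rewrite /rip linear0r /nrm normr0 expr0n/= mulr0.
  by rewrite -ler_pdivlMr ?npos//; apply: ge_sup (ubE _ xN); exists (- C).
exists (sup E) => //.
move=> [Y [/bounded_opP[_ [D D0 YD]] _ YS]].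
set S := T - _ in YS.
have bS : bounded_op S.
  by apply: bounded_opD => //; apply/bounded_opN/bounded_opZ/bounded_op_id.
have /bounded_opP[_ [K K0 SK]] := bS.
have lowS x : 0 <= rip ip (S x) x.
  by rewrite rip_scaler subr_ge0; exact: supE.
have sS : symmetric_op S by exact: symmetric_shift.
pose d := (D ^+ 2 * K)^-1; have d0 : 0 < d by rewrite invr_gt0 mulr_gt0// exprn_gt0.
suff /(ub_le_sup hsE.2) : E (sup E + d) by lra.
move=> x; rewrite mulrDl -lerBrDl.
have -> : rip ip (T x) x - sup E * nrm x ^+ 2 = rip ip (S x) x.
  by rewrite rip_scaler.
rewrite ler_pdivrMl ?mulr_gt0 ?exprn_gt0//.
have h1 := positive_sqr_le bS sS lowS K0 SK x.
have h2 : nrm x ^+ 2 <= D ^+ 2 * nrm (S x) ^+ 2.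
  rewrite -exprMn lerXn2r ?nnegrE ?mulr_ge0 ?nrm_ge0 ?(ltW D0)//.
  by rewrite -{1}[x]/(id x) -YS; exact: YD.
by apply: le_trans h2 _; rewrite -(mulrA _ K) ler_pM2l// exprn_gt0.
Qed.

End Coercive.

(** * Polynomials in an operator *)

Section Polynomial.
Variables (R : realType) (H : completeNormedModType R[i]).
Implicit Types (T : H -> H) (p q : {poly R[i]}) (r s : {poly R}).

(** Complex coefficients make the splitting into linear factors possible. *)
Definition cpoly_op q T : H -> H :=
  fun x => \sum_(i < size q) q`_i *: iter i T x.

Lemma cpoly_op_wide n q T x : (size q <= n)%N ->
  cpoly_op q T x = \sum_(i < n) q`_i *: iter i T x.
Proof.
move=> qn; rewrite /cpoly_op (big_ord_widen _ (fun i => q`_i *: iter i T x) qn).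
rewrite big_mkcond /=; apply: eq_bigr => i _; case: ltnP => // qi.
by rewrite nth_default// scale0r.
Qed.

Lemma op_hornerE r T : op_horner r T = cpoly_op (map_poly (real_complex R) r) T.
Proof.
apply/funext => x; rewrite /op_horner /cpoly_op fct_sumE size_map_poly.
by apply: eq_bigr => i _; rewrite coef_map.
Qed.

Lemma cpoly_opD p q T : cpoly_op (p + q) T = cpoly_op p T + cpoly_op q T.
Proof.
apply/funext => x; rewrite fctE; pose n := maxn (size p) (size q).
rewrite !(@cpoly_op_wide n) ?leq_maxl ?leq_maxr//; last exact: size_polyD.
by rewrite -big_split; apply: eq_bigr => i _; rewrite coefD scalerDl.
Qed.

Lemma cpoly_opZ a q T : cpoly_op (a *: q) T = a *: cpoly_op q T.
Proof.
apply/funext => x; rewrite fctE.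
rewrite !(@cpoly_op_wide (size q)) ?size_scale_leq// scaler_sumr.
by apply: eq_bigr => i _; rewrite coefZ scalerA.
Qed.

Lemma cpoly_opC a T : cpoly_op a%:P T = a *: id.
Proof.
apply/funext => x; rewrite fctE (@cpoly_op_wide 1) ?size_polyC ?leq_b1//.
by rewrite big_ord1 coefC eqxx.
Qed.

Lemma cpoly_opMX q T : cpoly_op (q * 'X) T = cpoly_op q T \o T.
Proof.
apply/funext => x /=.
rewrite (@cpoly_op_wide (size q).+1); last first.
  by rewrite (leq_trans (size_polyMleq _ _))// size_polyX addn2.
rewrite big_ord_recl coefMX/= scale0r add0r; apply: eq_bigr => i _.
  by rewrite coefMX -iterSr.
Qed.

Lemma cpoly_op_XsubC a T : cpoly_op ('X - a%:P) T = T - a *: id.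
Proof.
rewrite -['X]mul1r -polyCN cpoly_opD cpoly_opMX !cpoly_opC scaleNr.
by rewrite scale1r.
Qed.

Lemma cpoly_op_bounded q T : bounded_op T -> bounded_op (cpoly_op q T).
Proof.
move=> bT; elim/poly_ind: q => [|q c IH].
  by rewrite -polyC0 cpoly_opC; exact/bounded_opZ/bounded_op_id.
rewrite cpoly_opD cpoly_opMX cpoly_opC; apply: bounded_opD.
  exact: bounded_op_comp.
exact/bounded_opZ/bounded_op_id.
Qed.

Lemma cpoly_opM p q T : bounded_op T ->
  cpoly_op (p * q) T = cpoly_op p T \o cpoly_op q T.
Proof.
move=> bT; elim/poly_ind: q => [|q c IH].
  rewrite mulr0 -polyC0 cpoly_opC scale0r; apply/funext => x /=.
  have [/linear_pack[P ->] _] := cpoly_op_bounded p bT.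
  by rewrite linear0.
rewrite mulrDr mulrA (mulrC p c%:P) mul_polyC !cpoly_opD !cpoly_opMX cpoly_opZ.
rewrite cpoly_opC IH; apply/funext => x; rewrite !fctE /=.
have [/linear_pack[P ->] _] := cpoly_op_bounded p bT.
by rewrite linearD linearZ.
Qed.

(** Over [R[i]], [q] is a nonzero constant times a product of ['X - z] over its roots, so [q(T)] is
    a product of invertible operators. *)
Lemma cpoly_op_invertible q T : bounded_op T -> q != 0 ->
  (forall z, root q z -> invertible (T - z *: id)) -> invertible (cpoly_op q T).
Proof.
move=> bT q0; have [s qE] := closed_field_poly_normal q; rewrite qE => inv.
rewrite cpoly_opZ; apply: invertibleZ.
- exact: cpoly_op_bounded.
- by rewrite lead_coef_eq0.
have {inv} : forall z, z \in s -> invertible (T - z *: id).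
  by move=> z zs; apply: inv; rewrite rootZ ?lead_coef_eq0// root_prod_XsubC.
elim: s {qE} => [|z s IH] inv.
  rewrite big_nil -polyC1 cpoly_opC scale1r.
  by exists id; split=> //; exact: bounded_op_id.
rewrite big_cons cpoly_opM// cpoly_op_XsubC; apply: invertible_comp.
  by apply: inv; rewrite mem_head.
by apply: IH => w ws; apply: inv; rewrite inE ws orbT.
Qed.

Lemma op_horner_bounded r T : bounded_op T -> bounded_op (op_horner r T).
Proof. by move=> bT; rewrite op_hornerE; exact: cpoly_op_bounded. Qed.

Lemma op_hornerD r s T : op_horner (r + s) T = op_horner r T + op_horner s T.
Proof. by rewrite !op_hornerE rmorphD cpoly_opD. Qed.

Lemma op_hornerZ a r T : op_horner (a *: r) T = a%:C *: op_horner r T.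
Proof. by rewrite !op_hornerE map_polyZ cpoly_opZ. Qed.

Lemma op_hornerN r T : op_horner (- r) T = - op_horner r T.
Proof. by rewrite -scaleN1r op_hornerZ rmorphN1 scaleN1r. Qed.

Lemma op_hornerC a T : op_horner a%:P T = a%:C *: id.
Proof. by rewrite op_hornerE map_polyC cpoly_opC. Qed.

Lemma op_hornerX T : op_horner 'X T = T.
Proof.
by rewrite op_hornerE map_polyX -['X]mul1r -polyC1 cpoly_opMX cpoly_opC scale1r.
Qed.

Lemma op_hornerM r s T : bounded_op T ->
  op_horner (r * s) T = op_horner r T \o op_horner s T.
Proof. by move=> bT; rewrite !op_hornerE rmorphM cpoly_opM. Qed.

(** If no zero of [r] were in the real spectrum, [T - z] would be invertible at every complex root
    [z] of [r], real or not, and so would be [r(T)]. *)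
Lemma spectrum_root r T : bounded_op T -> r != 0 -> ~ invertible (op_horner r T) ->
  (forall z, complex.Im z != 0 -> invertible (T - z *: id)) ->
  exists2 t, spectrum T t%:C & r.[t] = 0.
Proof.
move=> bT r0 ninv nonreal; apply: contrapT => no; apply: ninv.
rewrite op_hornerE; apply: cpoly_op_invertible => //; first by rewrite map_poly_eq0.
move=> z rz; have [z0|] := eqVneq (complex.Im z) 0; last exact: nonreal.
apply: contrapT => ninv; apply: no.
have zE : z = (complex.Re z)%:C by rewrite {1}(complexE z) z0 mulr0 addr0.
exists (complex.Re z); first by rewrite -zE.
by move: rz; rewrite zE /root horner_map => /eqP/(@complexI R).
Qed.

End Polynomial.

(** * Functional calculus *)

Lemma uniform_seqP (R : realType) (A : set R) (g : nat -> R -> R) (f : R -> R) :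
  {uniform A, g @ \oo --> f} <->
  forall e, 0 < e -> \forall n \near \oo, forall t, A t -> `|g n t - f t| <= e.
Proof.
split=> [gf e e0|gf P /uniform_nbhs[E [/=]]].
  apply: (gf [set h | forall t, A t -> `|h t - f t| <= e]).
  apply/uniform_nbhs; exists [set xy | ball xy.1 e xy.2]; split.
    exact: entourage_ball (PosNum e0).
  by move=> h /= hE t /hE; rewrite /ball/= distrC => /ltW.
rewrite -entourage_ballE => -[e /= e0 eE] EP.
have e2 : 0 < e / 2 by rewrite divr_gt0.
near=> n; apply: EP => t At; apply: eE; rewrite /ball/= distrC.
apply: (@le_lt_trans _ _ (e / 2)); last by lra.
by move: t At; near: n; exact: gf.
Unshelve. all: by end_near. Qed.

Section Calculus.
Variables (R : realType) (H : completeNormedModType R[i]).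
Variable ip : {dot H for @Num.conj R[i]}.
Hypothesis ip_normE : ip_norm ip.
Variable T : H -> H.
Hypothesis T_bounded : bounded_op T.
Hypothesis T_symmetric : symmetric_op ip T.
Implicit Types (x y z : H) (X Y : H -> H) (a b e t : R) (f g : R -> R) (p q r : {poly R}).

Local Notation sp := [set t : R | spectrum T t%:C].

Lemma op_horner_symmetric r : symmetric_op ip (op_horner r T).
Proof.
elim/poly_ind: r => [|r c IH] x y.
  by rewrite -polyC0 op_hornerC !fctE ripZl ripZr.
rewrite op_hornerD op_hornerC !fctE ripDl ripDr ripZl ripZr.
by rewrite {1}mulrC !op_hornerM// op_hornerX /= T_symmetric IH.
Qed.

Lemma op_horner_ge0 r : (forall t, sp t -> 0 <= r.[t]) ->
  forall x, 0 <= rip ip (op_horner r T x) x.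
Proof.
move=> r0 x; rewrite leNgt; apply/negP => x0.
have xN : x != 0.
  by apply/eqP => xE; move: x0; rewrite xE /rip linear0r ltxx.
have [l low ninv] := symmetric_lower_bound ip_normE (op_horner_bounded r T_bounded)
  (op_horner_symmetric r) xN.
have l0 : l < 0.
  rewrite ltNge; apply/negP => l0; have := low x.
  have : 0 <= l * nrm x ^+ 2 by rewrite mulr_ge0 ?sqr_ge0.
  by lra.
suff [t st rt] : exists2 t, sp t & r.[t] = l by have := r0 t st; rewrite rt; lra.
(* When [r] is the constant [l], any spectral point will do; the lower bound of [T] itself provides
   one. *)
have [/eqP|rl] := eqVneq (r - l%:P) 0.
  rewrite subr_eq0 => /eqP ->.
  have [t _ st] := symmetric_lower_bound ip_normE T_bounded T_symmetric xN.
  by exists t => //; rewrite hornerC.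
have [|z z0|t st] := spectrum_root T_bounded rl.
- by rewrite op_hornerD -polyCN op_hornerC rmorphN/= scaleNr.
- exact: (symmetric_nonreal ip_normE).
by rewrite hornerD hornerN hornerC => /eqP; rewrite subr_eq0 => /eqP; exists t.
Qed.

(** Positivity of the polynomial [e^2 - r^2] on the spectrum gives [|r(T) x|^2 <= e^2 |x|^2], as
    [r(T)] is symmetric. *)
Lemma op_horner_norm_le r e : 0 <= e -> (forall t, sp t -> `|r.[t]| <= e) ->
  forall x, nrm (op_horner r T x) <= e * nrm x.
Proof.
move=> e0 re x.
rewrite -(@ler_pXn2r _ 2)// ?nnegrE ?mulr_ge0 ?nrm_ge0// exprMn !(nrm_sqr ip_normE).
have := @op_horner_ge0 ((e ^+ 2)%:P - r * r) _ x.
rewrite op_hornerD op_hornerN op_hornerC op_hornerM// !fctE ripDl ripNl ripZl.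
rewrite op_horner_symmetric subr_ge0; apply=> t /re rt.
rewrite hornerD hornerN hornerM hornerC subr_ge0 -expr2 -real_normK ?num_real//.
by rewrite lerXn2r ?nnegrE.
Qed.

(* Sequence-free form of [is_cfc]. *)
Definition fun_op f X : Prop := forall e, 0 < e -> exists p : {poly R},
  (forall t, sp t -> `|p.[t] - f t| <= e) /\
  forall x, nrm (op_horner p T x - X x) <= e * nrm x.

Lemma is_cfcP f X : is_cfc f T X <-> fun_op f X.
Proof.
split=> [[p [/uniform_seqP pf pX]] e e0|fX].
  have [n [h1 h2]] := filter_ex (filterI (pf e e0) (pX e e0)).
  exists (p n); split=> // x.
  by rewrite -lecR rmorphM/= -!nrmE.
have eps n : 0 < (n.+1%:R : R)^-1 by rewrite invr_gt0.
have [p pP] := choice (fun n => fX _ (eps n)).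
have small e : 0 < e -> \forall n \near \oo, (n.+1%:R : R)^-1 <= e.
  by move=> e0; apply: filterS (near_infty_natSinv_lt (PosNum e0)) => n /ltW.
exists p; split.
  apply/uniform_seqP => e /small; apply: filterS => n ne t st.
  exact: le_trans ((pP n).1 t st) ne.
move=> e /small; apply: filterS => n ne x.
rewrite !nrmE -rmorphM lecR; apply: le_trans ((pP n).2 x) _.
by rewrite ler_wpM2r ?nrm_ge0.
Qed.

Lemma fun_op_horner p : fun_op (horner p) (op_horner p T).
Proof.
move=> e e0; exists p; split=> [t _|x]; first by rewrite subrr normr0 ltW.
by rewrite subrr {1}/nrm normr0 mulr_ge0 ?nrm_ge0// ltW.
Qed.

(** [X] is only known as a limit. As [p(T)] is linear, the defect of linearity of [X] is, up to
    sign, that of the error [D = p(T) - X], hence arbitrarily small. *)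
Lemma fun_op_linear f X : fun_op f X -> linear X.
Proof.
move=> fX c x y; have c0 : 0 <= complex.Re `|c|.
  by rewrite -ler0c RRe_real// ger0_real.
apply: (@eq_eps _ _ _ _ (nrm (c *: x + y) + nrm x * complex.Re `|c| + nrm y)).
  by rewrite !addr_ge0 ?mulr_ge0 ?nrm_ge0.
move=> e e0; have [p [_ pX]] := fX e e0.
have [/linear_pack[P PE] _] := op_horner_bounded p T_bounded.
rewrite PE in pX; pose D z := P z - X z.
have XE z : X z = P z - D z by rewrite subKr.
have -> : X (c *: x + y) - (c *: X x + X y) = (c *: D x + D y) - D (c *: x + y).
  rewrite (XE (c *: x + y)) (XE x) (XE y) linearP scalerBr.
  by rewrite addrACA -opprD; move: (D _) => d; rewrite opprB [LHS]addrC subrKA.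
apply: le_trans (nrmD _ _) _; rewrite nrmN.
apply: le_trans (lerD (nrmD _ _) (pX _)) _.
have -> : nrm (c *: D x) = complex.Re `|c| * nrm (P x - X x).
  by rewrite /nrm normrZ -[`|c|]RRe_real ?ger0_real// complex_ReZ.
have := ler_wpM2l c0 (pX x); have := pX y; lra.
Qed.

Lemma fun_op_nrm_le f X a : 0 <= a -> fun_op f X -> (forall t, sp t -> `|f t| <= a) ->
  forall x, nrm (X x) <= a * nrm x.
Proof.
move=> a0 fX fa x; rewrite -subr_le0; apply: (@le0_eps _ _ (nrm x + nrm x)).
  by rewrite addr_ge0 ?nrm_ge0.
move=> e e0; have [p [pf pX]] := fX e e0.
have pa : forall t, sp t -> `|p.[t]| <= a + e.
  move=> t st; have := pf t st; have := fa t st.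
  by have := ler_distD (f t) p.[t] 0; rewrite !subr0; lra.
have ae : 0 <= a + e by lra.
have := op_horner_norm_le ae pa x; have := pX x.
have := nrmD (op_horner p T x) (X x - op_horner p T x).
by rewrite addrC subrK (nrmB (X x)); lra.
Qed.

Lemma fun_op_symmetric f X : fun_op f X -> symmetric_op ip X.
Proof.
have le f' X' x y : fun_op f' X' -> rip ip (X' x) y <= rip ip x (X' y).
  move=> fX; rewrite -subr_le0; apply: (@le0_eps _ _ (2 * (nrm x * nrm y))).
    by rewrite !mulr_ge0 ?nrm_ge0.
  move=> e e0; have [p [_ pX]] := fX e e0.
  have h1 := cauchy_schwarz ip_normE (- (op_horner p T x - X' x)) y.
  have h2 := cauchy_schwarz ip_normE x (op_horner p T y - X' y).
  rewrite nrmN ripNl ripDl ripNl in h1; rewrite ripDr ripNr in h2.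
  have := op_horner_symmetric p x y.
  have := ler_wpM2r (nrm_ge0 y) (pX x); have := ler_wpM2l (nrm_ge0 x) (pX y); nra.
move=> fX x y; apply/eqP; rewrite eq_le (le _ _ _ _ fX)/=.
by rewrite (ripC ip x) (ripC ip _ y) (le _ _ _ _ fX).
Qed.

Lemma fun_op_ge0 f X : fun_op f X -> (forall t, sp t -> 0 <= f t) ->
  forall x, 0 <= rip ip (X x) x.
Proof.
move=> fX f0 x; rewrite -oppr_le0; apply: (@le0_eps _ _ (2 * nrm x ^+ 2)).
  by rewrite mulr_ge0 ?sqr_ge0.
move=> e e0; have [p [pf pX]] := fX e e0.
(* The approximant may fall below 0 by as much as [e]; adding [e] restores positivity on the
   spectrum. *)
have := @op_horner_ge0 (p + e%:P) _ x.
rewrite op_hornerD op_hornerC !fctE ripDl ripZl -(nrm_sqr ip_normE) => h1.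
have {}h1 := h1 _.
have h2 := cauchy_schwarz ip_normE (op_horner p T x - X x) x.
rewrite ripDl ripNl in h2.
have h3 := ler_wpM2r (nrm_ge0 x) (pX x).
suff : 0 <= rip ip (op_horner p T x) x + e * nrm x ^+ 2 by rewrite expr2 in h3 *; lra.
apply: h1 => t st; rewrite hornerD hornerC.
by have := pf t st; have := f0 t st; rewrite ler_norml; lra.
Qed.

Lemma fun_opD f g X Y : fun_op f X -> fun_op g Y ->
  fun_op (fun t => f t + g t) (X + Y).
Proof.
move=> fX gY e e0; have e2 : 0 < e / 2 by lra.
have [p [pf pX]] := fX _ e2; have [q [qg qY]] := gY _ e2.
exists (p + q); split=> [t st|x].
  rewrite hornerD opprD addrACA; apply: le_trans (ler_normD _ _) _.
  by have := pf t st; have := qg t st; lra.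
rewrite op_hornerD !fctE opprD addrACA; apply: le_trans (nrmD _ _) _.
by have := pX x; have := qY x; lra.
Qed.

Lemma fun_opZ a f X : fun_op f X -> fun_op (fun t => a * f t) (a%:C *: X).
Proof.
move=> fX e e0; pose d := e / (`|a| + 1).
have a1 : 0 < `|a| + 1 by rewrite ltr_wpDl.
have d0 : 0 < d by rewrite divr_gt0.
have ad : `|a| * d <= e by rewrite /d mulrA ler_pdivrMr//; have := normr_ge0 a; nra.
have [p [pf pX]] := fX _ d0.
exists (a *: p); split=> [t st|x].
  rewrite hornerZ -mulrBr normrM; apply: le_trans ad.
  by rewrite ler_wpM2l// pf.
rewrite op_hornerZ !fctE -scalerBr nrmZ.
apply: le_trans (ler_wpM2l (normr_ge0 a) (pX x)) _.
by rewrite mulrA ler_wpM2r ?nrm_ge0.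
Qed.

(** The difference represents the zero function, so its norm bound is 0. *)
Lemma fun_op_unique f X Y : fun_op f X -> fun_op f Y -> X = Y.
Proof.
move=> fX fY; have := fun_opD fX (fun_opZ (-1) fY).
move=> /(fun_op_nrm_le (lexx 0)) XY; apply/funext => x.
apply/eqP; rewrite -subr_eq0 -nrm_eq0 eq_le nrm_ge0 andbT.
have := XY _ x; rewrite mul0r !fctE rmorphN1 scaleN1r; apply=> t _.
by rewrite mulN1r subrr normr0.
Qed.

Lemma eq_fun_op f g X : (forall t, sp t -> f t = g t) -> fun_op f X -> fun_op g X.
Proof.
move=> fg fX e e0; have [p [pf pX]] := fX e e0.
by exists p; split=> // t st; rewrite -fg// pf.
Qed.

Section BoundedSpectrum.
Variables (a b : R).
Hypothesis spectrum_ab : forall t, sp t -> a <= t <= b.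

Lemma horner_bounded p : exists2 c, 0 <= c & forall t, sp t -> `|p.[t]| <= c.
Proof.
elim/poly_ind: p => [|p k [c c0 pc]].
  by exists 0 => // t _; rewrite horner0 normr0.
exists (c * (`|a| + `|b|) + `|k|) => [|t st].
  by rewrite addr_ge0 ?mulr_ge0 ?addr_ge0.
rewrite hornerMXaddC; apply: le_trans (ler_normD _ _) _; rewrite lerD2r normrM.
rewrite ler_pM ?pc//; have /andP[ta tb] := spectrum_ab st.
have := ler_norm b; have := ler_norm (- a); rewrite normrN.
by have := normr_ge0 a; have := normr_ge0 b; rewrite ler_norml; lra.
Qed.

(** A polynomial within distance 1 of [f] is bounded on the bounded spectrum. *)
Lemma fun_op_bound f X : fun_op f X -> exists2 c, 0 < c & forall t, sp t -> `|f t| <= c.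
Proof.
move=> /(_ 1 ltr01)[p [pf _]]; have [c c0 pc] := horner_bounded p.
exists (c + 1) => [|t st]; first by rewrite ltr_wpDl.
have := pf t st; have := pc t st; have := ler_distD p.[t] (f t) 0.
by rewrite !subr0 (distrC (f t)); lra.
Qed.

Lemma fun_op_bounded f X : fun_op f X -> bounded_op X.
Proof.
move=> fX; apply/bounded_opP; split; first exact: fun_op_linear fX.
have [c c0 fc] := fun_op_bound fX; exists c => //.
exact: (fun_op_nrm_le (ltW c0) fX).
Qed.

Lemma fun_opM f g X Y : fun_op f X -> fun_op g Y ->
  fun_op (fun t => f t * g t) (X \o Y).
Proof.
move=> fX gY e e0.
have [c c0 fc] := fun_op_bound fX; have [d d0 gd] := fun_op_bound gY.
(* From [p q - f g = (p - f) q + f (q - g)] the error is at most [k (d + k) + c k], and [k <= 1]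
   reduces this to [(c + d + 1) k <= e]. *)
pose k := Num.min 1 (e / (c + d + 1)).
have k0 : 0 < k by rewrite lt_min ltr01 divr_gt0// !addr_gt0.
have k1 : k <= 1 by rewrite ge_min lexx.
have ke : (c + d + 1) * k <= e.
  by rewrite mulrC -ler_pdivlMr ?addr_gt0// ge_min lexx orbT.
have [p [pf pX]] := fX _ k0; have [q [qg qY]] := gY _ k0.
have qd t : sp t -> `|q.[t]| <= d + k.
  move=> st; have := qg t st; have := gd t st; have := ler_distD (g t) q.[t] 0.
  by rewrite !subr0; lra.
exists (p * q); split=> [t st|x].
  rewrite hornerM; have -> : p.[t] * q.[t] - f t * g t =
    (p.[t] - f t) * q.[t] + f t * (q.[t] - g t) by ring.
  apply: le_trans (ler_normD _ _) _; rewrite !normrM.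
  apply: le_trans (lerD (ler_pM _ _ (pf t st) (qd t st)) (ler_pM _ _ (fc t st) (qg t st))) _ => //.
  apply: le_trans ke; nra.
rewrite op_hornerM//=.
have [/linear_pack[X' XE] _] := fun_op_bounded fX.
have -> : op_horner p T (op_horner q T x) - X (Y x) =
  (op_horner p T (op_horner q T x) - X (op_horner q T x)) + X (op_horner q T x - Y x).
  by rewrite XE (linearB X') subrKA.
apply: le_trans (nrmD _ _) _.
have h1 := op_horner_norm_le (ltW (ltr_pwDl d0 (ltW k0))) qd x.
have h2 := ler_wpM2l (ltW k0) h1; have h3 := pX (op_horner q T x).
have h4 := fun_op_nrm_le (ltW c0) fX fc (op_horner q T x - Y x).
have h5 := ler_wpM2l (ltW c0) (qY x).
have h6 := ler_wpM2r (nrm_ge0 x) ke.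
have h7 : k * (k * nrm x) <= k * nrm x.
  by rewrite ler_wpM2l ?(ltW k0)// ler_piMl ?nrm_ge0.
nra.
Qed.

(** Weierstrass approximants [p n] on [[a, b]] give operators that are Cauchy in operator norm; [X]
    is their pointwise limit. *)
Lemma fun_op_exists f : (forall t, a <= t <= b -> {for t, continuous f}) ->
  exists X, fun_op f X.
Proof.
move=> cf; have eps n : 0 < (n.+1%:R : R)^-1 by rewrite invr_gt0.
have [p /= pP] := choice (fun n => weierstrass cf (eps n)).
have small e : 0 < e -> exists n0, forall n, (n0 <= n)%N -> (n.+1%:R : R)^-1 <= e.
  move=> e0; have [n0 _ n0P] := near_infty_natSinv_lt (PosNum e0).
  by exists n0 => n /n0P /ltW.
have close n m e x : (n.+1%:R : R)^-1 <= e -> (m.+1%:R : R)^-1 <= e -> 0 < e ->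
    nrm (op_horner (p n) T x - op_horner (p m) T x) <= 2 * e * nrm x.
  move=> ne me e0.
  have -> : op_horner (p n) T x - op_horner (p m) T x = op_horner (p n - p m) T x.
    by rewrite op_hornerD op_hornerN.
  apply: op_horner_norm_le => [|t /spectrum_ab tab]; first by lra.
  rewrite hornerD hornerN; have := le_trans (pP n t tab) ne; have := le_trans (pP m t tab) me.
  by have := ler_distD (f t) (p n).[t] (p m).[t]; rewrite (distrC (f t)); lra.
have /choice[X XP] : forall x, exists l, forall e, 0 < e -> exists n0, forall n,
    (n0 <= n)%N -> nrm (op_horner (p n) T x - l) <= e.
  move=> x; apply: cauchy_limit => e e0.
  pose k := e / (2 * (nrm x + 1)).
  have x1 : 0 < 2 * (nrm x + 1) by have := nrm_ge0 x; lra.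
  have k0 : 0 < k by rewrite divr_gt0.
  have [n0 n0k] := small k k0.
  exists n0 => n m /n0k nk /n0k mk; apply: le_trans (close _ _ _ x nk mk k0) _.
  have -> : e = 2 * k * (nrm x + 1) by rewrite /k; field; have := nrm_ge0 x; lra.
  by rewrite ler_wpM2l ?lerDl// mulr_ge0// ltW.
exists X => e e0; have e2 : 0 < e / 2 by lra.
have [n0 n0e] := small _ e2; exists (p n0); split=> [t /spectrum_ab tab|x].
  by have := le_trans (pP n0 t tab) (n0e n0 (leqnn _)); lra.
(* The rate of pointwise convergence depends on [x], but the Cauchy estimate does not: compare with
   a later approximant within [d] of [X x], then let [d] tend to 0. *)
rewrite -subr_le0; apply: (@le0_eps _ _ 1) => // d d0; rewrite mul1r.
have [n1 n1d] := XP x d d0.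
have h1 := n1d _ (leq_maxr n0 n1).
have h2 := close _ _ _ x (n0e _ (leqnn _)) (n0e _ (leq_maxl n0 n1)) e2.
have := nrm_dist (op_horner (p (maxn n0 n1)) T x) (op_horner (p n0) T x) (X x).
by rewrite (nrmB (X x)); lra.
Qed.

(** Existence ensures that [xget] does not return its default value. *)
Lemma cfcP f : (forall t, a <= t <= b -> {for t, continuous f}) -> fun_op f (cfc f T).
Proof.
move=> /fun_op_exists[X /is_cfcP fX]; apply/is_cfcP.
by apply: (@xgetPex _ 0 [set X | is_cfc f T X]); exists X.
Qed.

End BoundedSpectrum.

End Calculus.

(** * Operator means *)

Lemma powR_continuous (R : realType) (a t : R) : 0 < t ->
  {for t, continuous (fun s : R => s `^ a)}.
Proof.
move=> t0; apply/differentiable_continuous/derivable1_diffP.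
by have [] := is_derive1_powR a t0.
Qed.

Section Positive.
Variables (R : realType) (H : completeNormedModType R[i]).
Variable ip : {dot H for @Num.conj R[i]}.
Hypothesis ip_normE : ip_norm ip.
Implicit Types (x y : H) (T X Y D P : H -> H).

Lemma rip_i_symmetric T x : linear T -> symmetric_op ip T ->
  rip ip ('i *: T x) x = 0.
Proof.
move=> /linear_pack[T' ->] sT; have := ripi ip (T' x) x.
by rewrite sT linearZ/= (ripC ip x); lra.
Qed.

(** The order of [R[i]] also asks that [<T x, x>] be real, which symmetry supplies. *)
Lemma positive_opP T : linear T -> symmetric_op ip T ->
  positive_op ip T <-> forall x, 0 <= rip ip (T x) x.
Proof.
move=> linT sT; split=> T0 x; have := T0 x; rewrite lecE => /=; first by case/andP.
rewrite /rip => ->; rewrite andbT; have := rip_i_symmetric x linT sT.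
by rewrite ripiE; lra.
Qed.

(* Polarisation: [<T x, x>] is real for all [x], so [Im <T x, y>] and
   [Im <x, T y>] agree. *)
Lemma positive_symmetric T : linear T -> positive_op ip T -> symmetric_op ip T.
Proof.
move=> /linear_pack[T' ->] T0.
have real x : rip ip ('i *: T' x) x = 0.
  by have := T0 x; rewrite lecE ripiE => /andP[/eqP-> _]; rewrite oppr0.
have im x y : rip ip ('i *: T' x) y = rip ip ('i *: x) (T' y).
  have := real (x + y); rewrite linearD scalerDr !ripDl !ripDr !real.
  by rewrite (ripi ip x) (ripC ip x); lra.
move=> x y; have := im ('i *: x) y; rewrite linearZ/= !scalerA -expr2 sqr_i.
by rewrite !scaleN1r !ripNl; lra.
Qed.

(** Symmetry of [P] gives [<P D P x, x> = <D P x, P x>]. *)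
Lemma positive_sandwich X f D P : bounded_op X -> symmetric_op ip X ->
  bounded_op P -> symmetric_op ip P ->
  fun_op X f D -> (forall t, spectrum X t%:C -> 0 <= f t) ->
  positive_op ip (P \o D \o P).
Proof.
move=> bX sX bP sP fD f0; have linD := fun_op_linear bX fD.
have sD := fun_op_symmetric ip_normE bX sX fD.
apply/positive_opP => [|x y|x] /=.
- by move=> c x y /=; rewrite bP.1 linD bP.1.
- by rewrite sP sD sP.
- by rewrite sP; exact: (fun_op_ge0 ip_normE bX sX fD).
Qed.

End Positive.

(** * Real powers, and the means of [A] and [B] as congruences by [A^(1/2)] *)

Section PowerMean.
Variables (R : realType) (H : completeNormedModType R[i]).
Variable ip : {dot H for @Num.conj R[i]}.
Hypothesis ip_normE : ip_norm ip.

Section OpPow.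
Variables (A : H -> H) (a1 a2 : R).
Hypotheses (A_bounded : bounded_op A) (A_symmetric : symmetric_op ip A).
Hypothesis (a1_gt0 : 0 < a1).
Hypothesis A_bounds : forall x, a1 * nrm x ^+ 2 <= rip ip (A x) x <= a2 * nrm x ^+ 2.

Let A_spectrum t : spectrum A t%:C -> a1 <= t <= a2.
Proof. exact: spectrum_bounds. Qed.

Lemma op_pow_fun_op a : fun_op A (fun t => t `^ a) (op_pow A a).
Proof.
refine (cfcP ip_normE A_bounded A_symmetric
  A_spectrum _).
by move=> t /andP[a1t _]; apply/powR_continuous/(lt_le_trans a1_gt0 a1t).
Qed.

Lemma spectrum_gt0 t : spectrum A t%:C -> 0 < t.
Proof. by move=> /A_spectrum/andP[+ _]; exact: lt_le_trans. Qed.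

Lemma op_powD a b : op_pow A a \o op_pow A b = op_pow A (a + b).
Proof.
have ab := fun_opM ip_normE A_bounded A_symmetric
  A_spectrum (op_pow_fun_op a) (op_pow_fun_op b).
apply: (fun_op_unique ip_normE A_bounded A_symmetric ab).
apply: eq_fun_op (op_pow_fun_op (a + b)) => t /spectrum_gt0 t0.
by rewrite powRD ?(gt_eqF t0) ?implybT.
Qed.

Lemma op_pow0 : op_pow A 0 = id.
Proof.
apply: (fun_op_unique ip_normE A_bounded A_symmetric (op_pow_fun_op 0)).
have := fun_op_horner A 1%:P; rewrite op_hornerC scale1r; apply: eq_fun_op => t _.
by rewrite hornerC powRr0.
Qed.

Lemma op_pow1 : op_pow A 1 = A.
Proof.
apply: (fun_op_unique ip_normE A_bounded A_symmetric (op_pow_fun_op 1)).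
have := fun_op_horner A 'X; rewrite op_hornerX; apply: eq_fun_op => t /spectrum_gt0 t0.
by rewrite hornerX powRr1// ltW.
Qed.

Lemma op_pow_bounded a : bounded_op (op_pow A a).
Proof.
exact: (fun_op_bounded ip_normE A_bounded A_symmetric
  A_spectrum (op_pow_fun_op a)).
Qed.

Lemma op_pow_symmetric a : symmetric_op ip (op_pow A a).
Proof. exact: (fun_op_symmetric ip_normE A_bounded A_symmetric (op_pow_fun_op a)). Qed.

End OpPow.

Variables (A B : H -> H) (a1 a2 b1 b2 : R).
Hypotheses (A_bounded : bounded_op A) (A_symmetric : symmetric_op ip A).
Hypotheses (B_bounded : bounded_op B) (B_symmetric : symmetric_op ip B).
Hypotheses (a1_gt0 : 0 < a1) (a2_gt0 : 0 < a2) (b1_gt0 : 0 < b1) (b2_gt0 : 0 < b2).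
Hypothesis A_bounds : forall x, a1 * nrm x ^+ 2 <= rip ip (A x) x <= a2 * nrm x ^+ 2.
Hypothesis B_bounds : forall x, b1 * nrm x ^+ 2 <= rip ip (B x) x <= b2 * nrm x ^+ 2.

Let P := op_pow A 2^-1.
Let Q := op_pow A (- 2^-1).
Let X := Q \o B \o Q.

Let PQ x : P (Q x) = x.
Proof.
have := op_powD A_bounded A_symmetric a1_gt0 A_bounds 2^-1 (- 2^-1).
by rewrite subrr (op_pow0 A_bounded A_symmetric a1_gt0 A_bounds) => /(congr1 (@^~ x)).
Qed.

Let QP x : Q (P x) = x.
Proof.
have := op_powD A_bounded A_symmetric a1_gt0 A_bounds (- 2^-1) 2^-1.
by rewrite addNr (op_pow0 A_bounded A_symmetric a1_gt0 A_bounds) => /(congr1 (@^~ x)).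
Qed.

Let PP x : P (P x) = A x.
Proof.
have := op_powD A_bounded A_symmetric a1_gt0 A_bounds 2^-1 2^-1.
have -> : 2^-1 + 2^-1 = 1 :> R by lra.
by rewrite (op_pow1 A_bounded A_symmetric a1_gt0 A_bounds) => /(congr1 (@^~ x)).
Qed.

Let P_bounded : bounded_op P.
Proof. exact: op_pow_bounded A_bounds _. Qed.

Let Q_bounded : bounded_op Q.
Proof. exact: op_pow_bounded A_bounds _. Qed.

Let P_symmetric : symmetric_op ip P.
Proof. exact: op_pow_symmetric A_bounds _. Qed.

Let Q_symmetric : symmetric_op ip Q.
Proof. exact: op_pow_symmetric A_bounds _. Qed.

Let X_bounded : bounded_op X.
Proof. by apply: bounded_op_comp => //; exact: bounded_op_comp. Qed.

Let X_symmetric : symmetric_op ip X.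
Proof. by move=> x y; rewrite /X /= Q_symmetric B_symmetric Q_symmetric. Qed.

(** With [y = Q x] one has [<X x, x> = <B y, y>] and [<A y, y> = |x|^2], so [|y|^2] lies between
    [|x|^2 / a2] and [|x|^2 / a1]. *)
Let X_bounds x :
  b1 / a2 * nrm x ^+ 2 <= rip ip (X x) x <= b2 / a1 * nrm x ^+ 2.
Proof.
have -> : rip ip (X x) x = rip ip (B (Q x)) (Q x) by rewrite /X /= Q_symmetric.
have := B_bounds (Q x); have := A_bounds (Q x).
have -> : rip ip (A (Q x)) (Q x) = nrm x ^+ 2.
  by rewrite -PP PQ P_symmetric PQ (nrm_sqr ip_normE).
move=> /andP[h1 h2] /andP[h3 h4]; apply/andP; split.
  by apply: le_trans h3; rewrite -mulrA ler_pM2l// ler_pdivrMl.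
by apply: le_trans h4 _; rewrite -mulrA ler_pM2l// ler_pdivlMl.
Qed.

Let X_spectrum t : spectrum X t%:C -> b1 / a2 <= t <= b2 / a1.
Proof. exact: (spectrum_bounds ip_normE X_bounded X_bounds). Qed.

Let X_gt0 t : spectrum X t%:C -> 0 < t.
Proof.
by move=> /X_spectrum/andP[+ _]; apply: lt_le_trans; rewrite divr_gt0.
Qed.

Variables (nu s : R).
Hypotheses (nu_ge0 : 0 <= nu) (nu_le1 : nu <= 1) (s_ge1 : 1 <= s).
(** The inequality at [t] compares the arithmetic and geometric means, the one at [t^-1] the
    geometric and harmonic means. *)
Hypothesis young : forall t, b1 / a2 <= t <= b2 / a1 ->
  s * t `^ nu <= 1 - nu + nu * t.
Hypothesis youngV : forall t, b1 / a2 <= t <= b2 / a1 ->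
  s * (t^-1) `^ nu <= 1 - nu + nu * t^-1.

Let b1a2_gt0 : 0 < b1 / a2. Proof. by rewrite divr_gt0. Qed.

Let G := op_pow X nu.
Let V := op_pow X (-1).
(** Symbol of [A^(1/2) ((1 - nu) A^(-1) + nu B^(-1)) A^(1/2)] as a function of [X]; its reciprocal
    [Z] represents the harmonic mean. *)
Let k t := 1 - nu + nu * t `^ (-1).

Let k_gt0 t : 0 < t -> 0 < k t.
Proof.
move=> t0; have := powR_gt0 (-1) t0; rewrite /k.
have [->|n0] := eqVneq nu 0; first by rewrite subr0 mul0r addr0.
have {}n0 : 0 < nu by rewrite lt_neqAle eq_sym n0.
by move=> p0; rewrite ltr_wpDl ?subr_ge0// mulr_gt0.
Qed.

Let Z := cfc (fun t => (k t)^-1) X.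
Let K := (1 - nu)%:C *: (id : H -> H) + nu%:C *: V.

Let G_fun : fun_op X (fun t => t `^ nu) G.
Proof. exact: op_pow_fun_op X_bounds _. Qed.

Let V_fun : fun_op X (fun t => t `^ (-1)) V.
Proof. exact: op_pow_fun_op X_bounds _. Qed.

Let Z_fun : fun_op X (fun t => (k t)^-1) Z.
Proof.
refine (cfcP ip_normE X_bounded X_symmetric X_spectrum _).
move=> t /andP[tl _].
have t0 : 0 < t := lt_le_trans b1a2_gt0 tl.
apply: cvgV; first by rewrite gt_eqF// k_gt0.
apply: cvgD; first exact: cvg_cst.
by apply: cvgM; [exact: cvg_cst|exact: powR_continuous].
Qed.

Let id_fun c : fun_op X (fun=> c) (c%:C *: (id : H -> H)).
Proof.
have := fun_op_horner X c%:P; rewrite op_hornerC; apply: eq_fun_op => t _.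
by rewrite hornerC.
Qed.

Let X_fun : fun_op X (fun t => t) X.
Proof.
have := fun_op_horner X 'X; rewrite op_hornerX; apply: eq_fun_op => t _.
by rewrite hornerX.
Qed.

Let K_fun : fun_op X k K.
Proof. exact: fun_opD (id_fun _) (fun_opZ _ V_fun). Qed.

Let KZ x : K (Z x) = x.
Proof.
suff /(congr1 (@^~ x)) : K \o Z = id by [].
have KZ' := fun_opM ip_normE X_bounded X_symmetric X_spectrum K_fun Z_fun.
apply: (fun_op_unique ip_normE X_bounded X_symmetric KZ').
rewrite -(scale1r (id : H -> H)); apply: eq_fun_op (id_fun 1) => t /X_gt0 t0.
by rewrite mulfV// gt_eqF// k_gt0.
Qed.

Let ZK x : Z (K x) = x.
Proof.
suff /(congr1 (@^~ x)) : Z \o K = id by [].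
have ZK' := fun_opM ip_normE X_bounded X_symmetric X_spectrum Z_fun K_fun.
apply: (fun_op_unique ip_normE X_bounded X_symmetric ZK').
rewrite -(scale1r (id : H -> H)); apply: eq_fun_op (id_fun 1) => t /X_gt0 t0.
by rewrite mulVf// gt_eqF// k_gt0.
Qed.

Let V_bounded : bounded_op V.
Proof. exact: op_pow_bounded X_bounds _. Qed.

Let Z_bounded : bounded_op Z.
Proof. exact: (fun_op_bounded ip_normE X_bounded X_symmetric X_spectrum Z_fun). Qed.

Let VX x : V (X x) = x.
Proof.
have := op_powD X_bounded X_symmetric b1a2_gt0 X_bounds (-1) 1.
rewrite addNr (op_pow0 X_bounded X_symmetric b1a2_gt0 X_bounds).
by rewrite (op_pow1 X_bounded X_symmetric b1a2_gt0 X_bounds) => /(congr1 (@^~ x)).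
Qed.

Let XV x : X (V x) = x.
Proof.
have := op_powD X_bounded X_symmetric b1a2_gt0 X_bounds 1 (-1).
rewrite subrr (op_pow0 X_bounded X_symmetric b1a2_gt0 X_bounds).
by rewrite (op_pow1 X_bounded X_symmetric b1a2_gt0 X_bounds) => /(congr1 (@^~ x)).
Qed.

Let PXP x : P (X (P x)) = B x.
Proof. by rewrite /X /= QP PQ. Qed.

Lemma op_inv_sqrt : op_inv A = Q \o Q.
Proof.
apply: op_inv_eq; split; first exact: bounded_op_comp.
  by apply/funext => x /=; rewrite -PP !PQ.
by apply/funext => x /=; rewrite -PP !QP.
Qed.

Lemma op_inv_congruence : op_inv B = Q \o V \o Q.
Proof.
apply: op_inv_eq; split; first by apply: bounded_op_comp => //; exact: bounded_op_comp.
  by apply/funext => x /=; rewrite -PXP PQ XV PQ.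
by apply/funext => x /=; rewrite -PXP QP VX QP.
Qed.

(** The operator to invert is [Q K Q]; [P] inverts [Q] and [Z] inverts [K]. *)
Lemma harmonic_mean_congruence :
  op_inv ((1 - nu)%:C *: op_inv A + nu%:C *: op_inv B) = P \o Z \o P.
Proof.
have -> : (1 - nu)%:C *: op_inv A + nu%:C *: op_inv B = Q \o K \o Q.
  rewrite op_inv_sqrt op_inv_congruence; apply/funext => x; rewrite /K !fctE /=.
  have [/linear_pack[Q' ->] _] := Q_bounded.
  by rewrite linearD !linearZ.
apply: op_inv_eq; split; first by apply: bounded_op_comp => //; exact: bounded_op_comp.
  by apply/funext => x /=; rewrite QP KZ QP.
by apply/funext => x /=; rewrite PQ ZK PQ.
Qed.

Let sandwich f D E : E = P \o D \o P -> fun_op X f D ->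
  (forall t, b1 / a2 <= t <= b2 / a1 -> 0 <= f t) -> positive_op ip E.
Proof.
move=> -> fD f0; apply: (positive_sandwich ip_normE X_bounded X_symmetric _ _ fD) => //.
by move=> t /X_spectrum; exact: f0.
Qed.

(** The four differences are congruences by [P] of functions of [X], with symbols
    [1 - nu + nu t - s t^nu], [(s - 1) t^nu], [t^nu - s / k t] and [(s - 1) / k t], all nonnegative
    on the interval containing the spectrum. *)
Lemma operator_young :
  let arith := (1 - nu)%:C *: A + nu%:C *: B in
  let geom := power_mean nu A B in
  let harm := op_inv ((1 - nu)%:C *: op_inv A + nu%:C *: op_inv B) in
  [/\ loewner_le ip (s%:C *: geom) arith,
      loewner_le ip geom (s%:C *: geom),
      loewner_le ip (s%:C *: harm) geom
    & loewner_le ip harm (s%:C *: harm)].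
Proof.
move=> arith geom harm; rewrite /harm harmonic_mean_congruence.
have [/linear_pack[P' PE] _] := P_bounded.
have geomE x : geom x = P (G (P x)) by [].
split.
- apply: (sandwich _ (fun_opD (fun_opD (id_fun (1 - nu)) (fun_opZ nu X_fun))
    (fun_opZ (- s) G_fun))) => [|t tX]; last by have := young tX; lra.
  apply/funext => x; rewrite /arith !fctE /= geomE -PP -PXP PE !linearD !linearZ.
  by rewrite /= rmorphN/= scaleNr scalerN.
- apply: (sandwich _ (fun_opZ (s - 1) G_fun)) => [|t tX].
    apply/funext => x; rewrite !fctE /= geomE PE linearZ/= rmorphB/= scalerBl.
    by rewrite scale1r.
  by rewrite mulr_ge0 ?subr_ge0// powR_ge0.
- apply: (sandwich _ (fun_opD G_fun (fun_opZ (- s) Z_fun))) => [|t tX].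
    apply/funext => x; rewrite !fctE /= geomE PE linearD !linearZ/= rmorphN/=.
    by rewrite scaleNr scalerN.
  have t0 : 0 < t by case/andP: tX => + _; exact: lt_le_trans.
  have p0 : 0 < t `^ nu by exact: powR_gt0.
  (* The inequality at [t^-1] reads [s / t^nu <= k t], which rearranges to [s / k t <= t^nu]. *)
  have := youngV tX; rewrite powRVl ?(ltW t0)// => y.
  rewrite mulNr subr_ge0 ler_pdivrMr ?k_gt0// mulrC -ler_pdivrMr//.
  by rewrite /k powR_inv1 ?(ltW t0).
- apply: (sandwich _ (fun_opZ (s - 1) Z_fun)) => [|t tX].
    apply/funext => x; rewrite !fctE /= PE linearZ/= rmorphB/= scalerBl.
    by rewrite scale1r.
  have t0 : 0 < t by case/andP: tX => + _; exact: lt_le_trans.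
  by rewrite mulr_ge0 ?subr_ge0// invr_ge0 ltW// k_gt0.
Qed.

End PowerMean.

Theorem theorem2p7 (R : realType) (H : completeNormedModType R[i])
    (ip : {dot H for @Num.conj R[i]}) (ip_normE : ip_norm ip)
    (A B : H -> H) (A_bounded : bounded_op A) (B_bounded : bounded_op B)
    (A_positive : positive_op ip A) (B_positive : positive_op ip B)
    (m m' M M' : R)
    (m_gt0 : 0 < m) (m'_gt0 : 0 < m') (M_gt0 : 0 < M) (M'_gt0 : 0 < M')
    (bounds :
      [/\ loewner_le ip (scalar_op m') A, loewner_le ip A (scalar_op m),
          m < M,
          loewner_le ip (scalar_op M) B & loewner_le ip B (scalar_op M')]
      \/
      [/\ loewner_le ip (scalar_op m') B, loewner_le ip B (scalar_op m),
          m < M,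
          loewner_le ip (scalar_op M) A & loewner_le ip A (scalar_op M')])
    (h h' : R) (hE : h = M / m) (h'E : h' = M' / m')
    (nu : R) (nu_ge0 : 0 <= nu) (nu_le1 : nu <= 1)
    (r : R) (rE : r = Num.min nu (1 - nu)) :
  let S := (specht (h `^ r))%:C in
  let arith := (1 - nu)%:C *: A + nu%:C *: B in
  let geom := power_mean nu A B in
  let harm := op_inv ((1 - nu)%:C *: op_inv A + nu%:C *: op_inv B) in
  [/\ loewner_le ip (S *: geom) arith,
      loewner_le ip geom (S *: geom),
      loewner_le ip (S *: harm) geom
    & loewner_le ip harm (S *: harm)].
Proof.
have sA := positive_symmetric A_bounded.1 A_positive.
have sB := positive_symmetric B_bounded.1 B_positive.
have form T a b : loewner_le ip (scalar_op a) T -> loewner_le ip T (scalar_op b) ->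
    forall x, a * nrm x ^+ 2 <= rip ip (T x) x <= b * nrm x ^+ 2.
  move=> aT Tb x; have := aT x; have := Tb x; rewrite /scalar_op !fctE !lecE => /=.
  move=> /andP[_ +] /andP[_]; rewrite -![complex.Re _]/(rip ip _ _).
  by rewrite !ripDl !ripNl !ripZl -!(nrm_sqr ip_normE); lra.
have mM : m < M by case: bounds => -[].
have h1 : 1 <= h by rewrite hE ler_pdivlMr// mul1r ltW.
have h0 : 0 < h by exact: lt_le_trans h1.
have hV : h^-1 = m / M by rewrite hE invf_div.
have nu01 : 0 <= nu <= 1 by rewrite nu_ge0.
have S1 : 1 <= specht (h `^ r).
  apply: specht_ge1; rewrite -[leLHS](powRr0 h) ler_powR// rE le_min nu_ge0.
  by rewrite subr_ge0.
have young t : 0 < t -> h <= t \/ t <= h^-1 ->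
    specht (h `^ r) * t `^ nu <= 1 - nu + nu * t.
  by move=> t0 ht; rewrite rE; exact: specht_young.
case: bounds => -[l1 u1 _ l2 u2].
(* Under (i) the spectrum of [X] lies in [[M / m, M' / m']], so [t >= h] and [t^-1 <= h^-1]. *)
- have htE t : M / m <= t -> 0 < t /\ h <= t.
    by move=> ht; rewrite hE; split=> //; apply: lt_le_trans ht; rewrite divr_gt0.
  have Y := operator_young ip_normE A_bounded sA B_bounded sB m'_gt0 m_gt0 M_gt0 M'_gt0
    (form _ _ _ l1 u1) (form _ _ _ l2 u2) nu_ge0 nu_le1 S1.
  apply: Y => t /andP[/htE[t0 ht] _].
    by apply: young => //; left.
  apply: young; first by rewrite invr_gt0.
  by right; rewrite lef_pV2.
(* Under (ii) it lies in [[m' / M', m / M]], and the two branches of the scalar inequality are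
   exchanged. *)
- have htE t : m' / M' <= t <= m / M -> 0 < t /\ t <= h^-1.
    by move=> /andP[tl ht]; rewrite hV; split=> //; apply: lt_le_trans tl; rewrite divr_gt0.
  have Y := operator_young ip_normE A_bounded sA B_bounded sB M_gt0 M'_gt0 m'_gt0 m_gt0
    (form _ _ _ l2 u2) (form _ _ _ l1 u1) nu_ge0 nu_le1 S1.
  apply: Y => t /htE[t0 ht].
    by apply: young => //; right.
  apply: young; first by rewrite invr_gt0.
  by left; rewrite -[h]invrK lef_pV2// posrE invr_gt0.
Qed.
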